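(* Let $R$ be a complete discrete valuation ring with fraction field $K$ and finite residue field $k$ of characteristic $p$. Let $\mathcal{X}/R\subseteq\mathbb{P}^N_R$ be a smooth projective model of $X/K$, a non-singular irreducible projective variety of dimension $d$. Let $\phi_R:\mathcal{X}/R\to\mathcal{X}/R$ be an $R$-morphism and let $P_R\in\mathcal{X}(R)$ be a periodic point of primitive period $n$ for $\phi_R$, with reduction $\overline{P}$ of primitive period $m$. Then $$n=m$$ or there exists a $\phi$-stable subspace $V$ of the cotangent space of $\mathcal{X}\times_R\operatorname{Spec} k$ such that $$n=m\,r_V\,p^e\quad\text{with } e\ge 0,$$ where $r_V$ is the order of the map induced by $\overline{\phi^m}$ on $V$. Furthermore, let $\mathcal{V}\subset\mathcal{X}$ be the scheme-theoretic union of $\{P_R,\phi_R(P_R),\ldots,\phi_R^{n-1}(P_R)\}$. Then $V$ is the cotangent space of $\mathcal{V}\times_R\operatorname{Spec} k$. Let $d'\le d$ be the dimension of $V$; then $$r_V\le (N\pi)^{d'}-1,$$ where $N\pi$ is the norm of $\pi$.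
   Context: $R$ is a discrete valuation ring, complete with respect to a normalized valuation $v$, with maximal ideal $\mathfrak{m}$ and uniformizer $\pi$; $K$ is its fraction field, $k=R/\mathfrak{m}$ is finite of characteristic $p$, and $N\pi=\#k$ is the norm of $\pi$. A smooth projective model of $X/K$ is a smooth projective $R$-scheme $\mathcal{X}$ with generic fiber $X$. $\overline{\phi}$ and $\overline{\phi^m}$ denote the restrictions of $\phi_R$ and $\phi_R^m$ to the special fiber $\mathcal{X}\times_R\operatorname{Spec} k$, and $\overline{P}$ is the restriction of $P_R$ to $\operatorname{Spec} k$; its primitive period is taken with respect to $\overline{\phi}$. The primitive period of a periodic point is the least positive integer $s$ such that the $s$-th iterate of the map fixes the point. Cotangent spaces are taken at $\overline{P}$, which is fixed by $\overline{\phi^m}$, and $\phi$-stable means stable under the linear map induced by $\overline{\phi^m}$ on the cotangent space. *)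

(* Defs.v *)
(* Conventions.  A closed subscheme of P^N over a ring A is given by a
   homogeneous ideal of A[x_0, ..., x_N].  Two homogeneous ideals with the same
   saturation define the same subscheme; the notions below that speak about the
   subscheme do not depend on the choice, so the ideal is not required to be
   saturated.  Ideals are Prop-valued predicates. *)
From mathcomp Require Import all_boot all_order all_algebra.
From mathcomp Require Import mpoly.

Set Implicit Arguments.
Unset Strict Implicit.
Unset Printing Implicit Defensive.

Import Order.TTheory GRing.Theory Num.Theory.
Local Open Scope ring_scope.

(** ** Complete discrete valuation rings *)

(* v 0 = +oo is not represented: the value of v at 0 is never used. *)
Definition normalized_valuation (K : fieldType) (v : K -> int) : Prop :=
  [/\ forall x y, x != 0 -> y != 0 -> v (x * y) = v x + v y,
      forall x y, x != 0 -> y != 0 -> x + y != 0 ->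
        Num.min (v x) (v y) <= v (x + y)
    & exists2 pi, pi != 0 & v pi = 1].

Definition valuation_ring (R : idomainType) (v : {fraction R} -> int) : Prop :=
  forall x : {fraction R}, x != 0 ->
    (0 <= v x <-> exists a : R, x = tofrac a).

(* |a - b| <= e^(-M) for the absolute value attached to v *)
Definition val_close (R : idomainType) (v : {fraction R} -> int) (M : int)
    (a b : R) : Prop :=
  a = b \/ M <= v (tofrac (a - b)).

Definition val_complete (R : idomainType) (v : {fraction R} -> int) : Prop :=
  forall u : nat -> R,
    (forall M, exists n0, forall i j, (n0 <= i)%N -> (n0 <= j)%N ->
       val_close v M (u i) (u j)) ->
    exists l, forall M, exists n0, forall i, (n0 <= i)%N ->
       val_close v M (u i) l.

Definition complete_dvr (R : idomainType) (v : {fraction R} -> int) : Prop :=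
  [/\ normalized_valuation v, valuation_ring v & val_complete v].

(* rho identifies k with R modulo its ideal of non-units. *)
Definition residue_map (R : idomainType) (k : fieldType)
    (rho : {rmorphism R -> k}) : Prop :=
  (forall y, exists x, rho x = y) /\
  (forall x, rho x = 0 <-> x \isn't a GRing.unit).

(** ** Closed subschemes of projective space *)

Definition ideal (S : nzRingType) (I : S -> Prop) : Prop :=
  [/\ I 0, forall f g, I f -> I g -> I (f + g) & forall h f, I f -> I (h * f)].

Definition homogeneous_ideal (A : comNzRingType) (N : nat)
    (I : {mpoly A[N.+1]} -> Prop) : Prop :=
  ideal I /\ forall e f, I f -> I (pihomog mdeg e f).

(* The points of the scheme defined by I: relevant homogeneous primes
   containing I. *)
Definition is_point (A : comNzRingType) (N : nat)
    (I p : {mpoly A[N.+1]} -> Prop) : Prop :=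
  [/\ homogeneous_ideal p,
      forall f g, p (f * g) -> p f \/ p g,
      forall f, I f -> p f
    & exists i, ~ p 'X_i].

(* The form f, as a section of a twist of the structure sheaf of the subscheme
   of I, is zero on the open set where the form h does not vanish.  Multiplying
   h by the x_i covers this set by affine pieces, also when h has degree 0. *)
Definition zero_on (A : comNzRingType) (N : nat)
    (I : {mpoly A[N.+1]} -> Prop) (h f : {mpoly A[N.+1]}) : Prop :=
  forall i, exists M, I (('X_i * h) ^+ M * f).

(* Integral: the saturation of I is prime, and there is a point. *)
Definition variety (F : fieldType) (N : nat)
    (I : {mpoly F[N.+1]} -> Prop) : Prop :=
  (exists p, is_point I p) /\
  forall (f g : {mpoly F[N.+1]}) e e', f \is e.-homog -> g \is e'.-homog ->
    zero_on I 1 (f * g) -> zero_on I 1 f \/ zero_on I 1 g.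

Definition point_chain (A : comNzRingType) (N : nat)
    (I : {mpoly A[N.+1]} -> Prop) (l : nat) : Prop :=
  exists c : nat -> {mpoly A[N.+1]} -> Prop,
    (forall i, (i <= l)%N -> is_point I (c i)) /\
    (forall i, (i < l)%N ->
       (forall f, c i f -> c i.+1 f) /\ (exists f, c i.+1 f /\ ~ c i f)).

(* Krull dimension *)
Definition dimension (A : comNzRingType) (N : nat)
    (I : {mpoly A[N.+1]} -> Prop) (d : nat) : Prop :=
  point_chain I d /\ ~ point_chain I d.+1.

(* Smoothness over the base ring A, of relative dimension r, at the point p:
   on an affine chart x_c <> 0 containing p, the ideal of the subscheme is
   generated near p by s = N - r equations g_1, ..., g_s whose differentials
   are linearly independent at p, i.e. some s x s minor of the Jacobian matrix
   in the affine coordinates x_j / x_c (j <> c) is nonzero in the residue field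
   of p. *)
Definition smooth_at (A : comNzRingType) (N : nat)
    (I p : {mpoly A[N.+1]} -> Prop) (r : nat) : Prop :=
  exists (s : nat) (g : 'I_s -> {mpoly A[N.+1]}) (c : 'I_N.+1)
         (col : 'I_s -> 'I_N.+1),
    [/\ (r + s = N)%N,
        forall i, I (g i) /\ exists e, g i \is e.-homog,
        forall f e, I f -> f \is e.-homog ->
          exists h, [/\ exists e', h \is e'.-homog, ~ p h
            & exists q : 'I_s -> {mpoly A[N.+1]}, h * f = \sum_i q i * g i]
      & [/\ ~ p 'X_c, forall i, col i != c
          & ~ p (\det (\matrix_(i < s, j < s) (g i)^`M(col j)))]].

Definition smooth (A : comNzRingType) (N : nat)
    (I : {mpoly A[N.+1]} -> Prop) : Prop :=
  forall p, is_point I p -> exists r, smooth_at I p r.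

Definition nonsingular_of_dimension (F : fieldType) (N : nat)
    (I : {mpoly F[N.+1]} -> Prop) (d : nat) : Prop :=
  dimension I d /\ forall p, is_point I p -> smooth_at I p d.

(* The ideal generated by the image of I under A -> B. *)
Definition base_change (A B : comNzRingType) (rho : {rmorphism A -> B})
    (N : nat) (I : {mpoly A[N.+1]} -> Prop) (f : {mpoly B[N.+1]}) : Prop :=
  exists (l : nat) (q : 'I_l -> {mpoly B[N.+1]}) (g : 'I_l -> {mpoly A[N.+1]}),
    (forall i, I (g i)) /\ f = \sum_i q i * map_mpoly rho (g i).

Definition generic_fiber (R : idomainType) (N : nat)
    (I : {mpoly R[N.+1]} -> Prop) : {mpoly {fraction R}[N.+1]} -> Prop :=
  base_change (@tofrac R : {rmorphism R -> {fraction R}}) I.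

(** ** Rational points over a local ring *)

(* Over a local ring A, an A-point of P^N is a vector having an invertible
   coordinate, up to multiplication by a unit. *)
Definition unimodular (A : comUnitRingType) (N : nat)
    (a : 'I_N.+1 -> A) : Prop :=
  exists i, a i \is a GRing.unit.

Definition same_point (A : comUnitRingType) (N : nat)
    (a b : 'I_N.+1 -> A) : Prop :=
  exists2 u, u \is a GRing.unit & forall i, b i = u * a i.

Definition rational_point (A : comUnitRingType) (N : nat)
    (I : {mpoly A[N.+1]} -> Prop) (a : 'I_N.+1 -> A) : Prop :=
  unimodular a /\ forall f e, I f -> f \is e.-homog -> f.@[a] = 0.

(** ** Endomorphisms *)

(* A morphism from a closed subscheme of P^N to P^N is given by a family of
   tuples (F_0, ..., F_N) of forms of the same degree; the member phi j defines
   it on the open set where its components do not all vanish. *)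
Definition charts (J : Type) (A : comNzRingType) (N : nat) : Type :=
  J -> N.+1.-tuple {mpoly A[N.+1]}.

Definition endomorphism (A : comNzRingType) (N : nat)
    (I : {mpoly A[N.+1]} -> Prop) (J : Type) (phi : charts J A N) : Prop :=
  [/\ forall j, exists e, forall i, tnth (phi j) i \is e.-homog,
      (* these open sets cover the subscheme *)
      forall p, is_point I p -> exists j c, ~ p (tnth (phi j) c),
      (* the members agree where they are both defined *)
      forall j j' c c' a b,
        zero_on I (tnth (phi j) c * tnth (phi j') c')
          (tnth (phi j) a * tnth (phi j') b - tnth (phi j) b * tnth (phi j') a)
    & (* the image is contained in the subscheme *)
      forall j c f e, I f -> f \is e.-homog ->
        zero_on I (tnth (phi j) c) (f \mPo phi j)].

Definition charts_base_change (A B : comNzRingType) (rho : {rmorphism A -> B})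
    (N : nat) (J : Type) (phi : charts J A N) : charts J B N :=
  fun j => map_tuple (map_mpoly rho) (phi j).

Fixpoint chart_comp (A : comNzRingType) (N : nat) (J : Type)
    (phi : charts J A N) (s : seq J) : N.+1.-tuple {mpoly A[N.+1]} :=
  if s is j :: s' then
    [tuple tnth (phi j) i \mPo chart_comp phi s' | i < N.+1]
  else [tuple 'X_i | i < N.+1].

(* The charts of the s-th iterate of phi. *)
Definition iterate (A : comNzRingType) (N : nat) (J : Type)
    (phi : charts J A N) (s : nat) : charts (s.-tuple J) A N :=
  fun t => chart_comp phi t.
Arguments iterate {A N J} phi s.

Definition chart_eval (A : comNzRingType) (N : nat)
    (F : N.+1.-tuple {mpoly A[N.+1]}) (a : 'I_N.+1 -> A) : 'I_N.+1 -> A :=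
  fun i => (tnth F i).@[a].

(* phi maps the point a to the point b *)
Definition sends (A : comUnitRingType) (N : nat) (J : Type)
    (phi : charts J A N) (a b : 'I_N.+1 -> A) : Prop :=
  exists j, unimodular (chart_eval (phi j) a) /\
            same_point (chart_eval (phi j) a) b.

Definition primitive_period (A : comUnitRingType) (N : nat) (J : Type)
    (phi : charts J A N) (a : 'I_N.+1 -> A) (n : nat) : Prop :=
  [/\ (0 < n)%N, sends (iterate phi n) a a
    & forall s, (0 < s < n)%N -> ~ sends (iterate phi s) a a].

(* The ideal of the scheme-theoretic union of a, phi(a), ..., phi^(n-1)(a): the
   intersection of the homogeneous ideals of these points. *)
Definition orbit_ideal (A : comUnitRingType) (N : nat) (J : Type)
    (phi : charts J A N) (a : 'I_N.+1 -> A) (n : nat)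
    (f : {mpoly A[N.+1]}) : Prop :=
  forall i b, (i < n)%N -> sends (iterate phi i) a b ->
    forall e, (pihomog mdeg e f).@[b] = 0.

(** ** Cotangent spaces *)

(* Germs at the rational point a are represented by fractions s.1 / s.2 of forms
   of the same degree with s.2(a) <> 0. *)
Definition germ (F : fieldType) (N : nat) : Type :=
  ({mpoly F[N.+1]} * {mpoly F[N.+1]})%type.

Definition germ_add (F : fieldType) (N : nat) (s t : germ F N) : germ F N :=
  (s.1 * t.2 + t.1 * s.2, s.2 * t.2).

Definition germ_mul (F : fieldType) (N : nat) (s t : germ F N) : germ F N :=
  (s.1 * t.1, s.2 * t.2).

Definition germ_scale (F : fieldType) (N : nat) (c : F) (s : germ F N) :
    germ F N :=
  (c *: s.1, s.2).

Definition germ_at (F : fieldType) (N : nat) (a : 'I_N.+1 -> F)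
    (s : germ F N) : Prop :=
  s.2.@[a] != 0 /\ exists e, s.1 \is e.-homog /\ s.2 \is e.-homog.

(* Equality in the local ring at a of the subscheme of I. *)
Definition germ_eq (F : fieldType) (N : nat) (I : {mpoly F[N.+1]} -> Prop)
    (a : 'I_N.+1 -> F) (s t : germ F N) : Prop :=
  exists h e, [/\ h \is e.-homog, h.@[a] != 0
                & I (h * (s.1 * t.2 - t.1 * s.2))].

Definition max_ideal (F : fieldType) (N : nat) (a : 'I_N.+1 -> F)
    (s : germ F N) : Prop :=
  germ_at a s /\ s.1.@[a] = 0.

Definition max_ideal_sq (F : fieldType) (N : nat)
    (I : {mpoly F[N.+1]} -> Prop) (a : 'I_N.+1 -> F) (s : germ F N) : Prop :=
  exists l : seq (germ F N * germ F N),
    (forall st, st \in l -> max_ideal a st.1 /\ max_ideal a st.2) /\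
    germ_eq I a s
      (foldr (fun st r => germ_add (germ_mul st.1 st.2) r) (0, 1) l).

(* W, with the map dW from the maximal ideal, is the cotangent space (maximal
   ideal modulo its square) at a of the subscheme of I.  Fractions equal in the
   local ring have the same image, by the third condition. *)
Definition cotangent_space (F : fieldType) (N : nat)
    (I : {mpoly F[N.+1]} -> Prop) (a : 'I_N.+1 -> F)
    (W : vectType F) (dW : germ F N -> W) : Prop :=
  [/\ forall s t, max_ideal a s -> max_ideal a t ->
        dW (germ_add s t) = dW s + dW t,
      forall c s, max_ideal a s -> dW (germ_scale c s) = c *: dW s,
      forall s, max_ideal a s -> (dW s = 0 <-> max_ideal_sq I a s)
    & forall w, exists2 s, max_ideal a s & dW s = w].

Definition germ_pullback (F : fieldType) (N : nat)
    (G : N.+1.-tuple {mpoly F[N.+1]}) (s : germ F N) : germ F N :=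
  (s.1 \mPo G, s.2 \mPo G).

(* L is the linear map induced on the cotangent space W at a by the morphism
   phi, which fixes a. *)
Definition induced_map (F : fieldType) (N : nat) (a : 'I_N.+1 -> F)
    (J : Type) (phi : charts J F N) (W : vectType F) (dW : germ F N -> W)
    (L : 'End(W)) : Prop :=
  forall j s, unimodular (chart_eval (phi j) a) -> max_ideal a s ->
    L (dW s) = dW (germ_pullback (phi j) s).

Definition order_on (F : fieldType) (W : vectType F) (L : 'End(W))
    (V : {vspace W}) (r : nat) : Prop :=
  [/\ (0 < r)%N, forall w, w \in V -> iter r L w = w
    & forall s, (0 < s < r)%N -> ~ (forall w, w \in V -> iter s L w = w)].

(* The subspace V of W, with the map induced by L, is isomorphic to the space T
   with its map M. *)
Definition identified_with (F : fieldType) (W T : vectType F) (L : 'End(W))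
    (V : {vspace W}) (M : 'End(T)) : Prop :=
  exists g : 'Hom(T, W),
    [/\ lker g = 0%VS, limg g = V & forall x, g (M x) = L (g x)].

(* Main.v *)
(* Replace phi by f = phi^m and let A be the ring of the functions regular at P,
   restricted to the f-orbit of P, that is, of sequences i |-> g(f^i(P)), with
   maximal ideal N and the shift s.  The cotangent space T of the special fiber
   of the orbit is N / (N^2 + pi A), and s induces on it a map M whose order r
   divides n/m.  Write n/m = r p^e t with t prime to p and u = s^(r p^e).  Then u
   is the identity on T, so for g in N the sequence d = u g - g lies in
   N^2 + pi A.  If all the differences u h - h, for h in A, are divisible by
   pi^c, then u d - d is divisible by pi^(c+1), and as the sum of the u^j d for
   j < t vanishes, so is t d, hence d.  By induction u is the identity on A, and
   since functions separate points t = 1.  If T = 0 the same induction shows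
   that all the sequences are constant, hence n = m.
     T is a quotient of the cotangent space W of the special fiber of X.  A
   matrix is similar to its transpose, so that a quotient of W, compatibly with
   the maps, is also a subspace V of W.  Finally \dim W <= d by the Jacobian
   criterion, the relative dimension at the reduction of P being also the one at
   the generic point of the section P. *)
From HB Require Import structures.
Require Import Defs.
From mathcomp Require Import all_boot all_order all_algebra.
From mathcomp Require Import mpoly.
From mathcomp Require Import perm zify ring.
From Stdlib Require Import Classical ClassicalEpsilon.
Set Implicit Arguments.
Unset Strict Implicit.
Unset Printing Implicit Defensive.
Import Order.TTheory GRing.Theory Num.Theory.
Local Open Scope ring_scope.

(** * Similarity of a matrix and its transpose *)

Definition krylov (F : fieldType) n (A : 'M[F]_n) (u : 'rV_n) D : 'M_(D, n) :=
  \matrix_(i < D) (u *m A ^+ i).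

Lemma row_krylov (F : fieldType) n (A : 'M[F]_n) (u : 'rV_n) D i :
  row i (krylov A u D) = u *m A ^+ i.
Proof. by rewrite rowK. Qed.

(** The first [D] rows are independent and the family of [D.+1] rows has rank at most [D], so both
    span the same space. Multiplication by [A] shifts each row to the next one, which stays in that
    span. *)
Lemma krylov_stable (F : fieldType) n (A : 'M[F]_n) (u : 'rV_n) D :
  row_free (krylov A u D) -> (\rank (krylov A u D.+1) <= D)%N ->
  (krylov A u D *m A <= krylov A u D)%MS.
Proof.
move=> free rk.
have sub : (krylov A u D <= krylov A u D.+1)%MS.
  apply/row_subP=> i; rewrite row_krylov.
  have -> : u *m A ^+ i = row (widen_ord (leqnSn D) i) (krylov A u D.+1).
    by rewrite row_krylov.
  exact: row_sub.
have eqm : (krylov A u D.+1 <= krylov A u D)%MS.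
  by rewrite -(geq_leqif (mxrank_leqif_sup sub)) (eqP free).
apply: submx_trans eqm; apply/row_subP=> i.
rewrite row_mul row_krylov -mulmxA.
have -> : A ^+ i *m A = A ^+ i.+1 by rewrite exprSr.
rewrite -[i.+1]/(nat_of_ord (lift ord0 i)) -row_krylov; exact: row_sub.
Qed.


(** Reversing the columns gives a lower triangular matrix with ones on the diagonal. The values
    [f i] with [i >= D] land below the diagonal and are unconstrained. *)
Lemma hankel_unit (F : fieldType) D (f : nat -> F) :
  (forall i, (i < D)%N -> f i = (i.+1 == D)%:R) ->
  (\matrix_(i < D, j < D) f (i + j)%N) \in unitmx.
Proof.
move=> Hf; set H := \matrix_(_, _) _.
have E i j : col_perm (perm (@rev_ord_inj D)) H i j = f (i + (D - j.+1))%N.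
  by rewrite !mxE permE.
suff : col_perm (perm (@rev_ord_inj D)) H \in unitmx.
  by rewrite col_permE unitmx_mul => /andP[].
rewrite unitmxE det_trig; last first.
  apply/is_trig_mxP=> i j lij; rewrite E Hf.
    by rewrite (_ : _ == D = false) //; apply/negbTE; move: (ltn_ord j); lia.
  by move: (ltn_ord j); lia.
rewrite big1 ?unitr1 // => i _; rewrite E Hf; last by move: (ltn_ord i); lia.
by rewrite (_ : _ == D) //; apply/eqP; move: (ltn_ord i); lia.
Qed.


(** Independent rows admit a linear form with arbitrary prescribed values: here 0 on all of them but
    the last, and 1 on the last. *)
Lemma krylov_dual (F : fieldType) n (A : 'M[F]_n) (u : 'rV_n) D :
  row_free (krylov A u D) ->
  exists w : 'rV_n, forall i, (i < D)%N ->
    (u *m A ^+ i *m w^T) 0 0 = (i.+1 == D)%:R.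
Proof.
move=> free.
pose c : 'cV[F]_D := \col_i ((i : nat).+1 == D)%:R.
exists (pinvmx (krylov A u D) *m c)^T => i iD; rewrite trmxK.
rewrite -(row_krylov A u (Ordinal iD)) -row_mul mulmxA mulmxVp // mul1mx.
by rewrite !mxE.
Qed.

Lemma trmxX (F : fieldType) n (A : 'M[F]_n) i : A^T ^+ i = (A ^+ i)^T.
Proof.
elim: i => [|i IH]; first by rewrite !expr0 trmx1.
by rewrite exprS exprSr IH -[RHS]/((A ^+ i *m A)^T) trmx_mul.
Qed.

(** The Gram matrix of the two families depends on [i + j] only. This Hankel shape yields its
    invertibility and also its symmetry. *)
Lemma krylov_hankel (F : fieldType) n (A : 'M[F]_n) (u w : 'rV_n) D :
  krylov A u D *m (krylov A^T w D)^T =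
  \matrix_(i, j) (u *m A ^+ (i + j) *m w^T) 0 0.
Proof.
apply/matrixP=> i j; rewrite [RHS]mxE exprD.
transitivity ((row i (krylov A u D) *m (row j (krylov A^T w D))^T) 0 0).
  by rewrite !mxE; apply: eq_bigr => l _; rewrite !mxE.
rewrite !row_krylov trmxX trmx_mul trmxK.
by rewrite -[A ^+ i * A ^+ j]/(A ^+ i *m A ^+ j) !mulmxA.
Qed.

(* Taking D maximal among the free Krylov families of both A and A^T makes the
   families of u and of w both stable, so no cyclic decomposition theorem is
   needed. *)
Lemma krylov_pair (F : fieldType) n (A : 'M[F]_n) : (0 < n)%N ->
  exists D u w, [/\ (0 < D)%N, (forall i, (i < D)%N ->
      (u *m A ^+ i *m w^T) 0 0 = (i.+1 == D)%:R),
    krylov A u D *m (krylov A^T w D)^T \in unitmx,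
    (krylov A u D *m A <= krylov A u D)%MS &
    (krylov A^T w D *m A^T <= krylov A^T w D)%MS].
Proof.
move=> n0.
pose free (B : 'M[F]_n) D := exists u : 'rV_n, row_free (krylov B u D).
pose P D := free A D \/ free A^T D.
have P1 : P 1%N.
  left; exists (delta_mx 0 (Ordinal n0)).
  rewrite -row_leq_rank lt0n mxrank_eq0; apply/eqP => /matrixP /(_ 0 (Ordinal n0)).
  by rewrite mxE expr0 mulmx1 !mxE !eqxx => /eqP; rewrite oner_eq0.
have leP D : P D -> (D <= n)%N.
  by case=> -[u]; rewrite -row_leq_rank => /leq_trans; apply; apply: rank_leq_col.
have [D [D0 PD nPD]] : exists D, [/\ (0 < D)%N, P D & ~ P D.+1].
  apply: NNPP => H.
  have : forall D, P D.+1.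
    by elim=> // D IH; apply: NNPP => nP; apply: H; exists D.+1.
  by move/(_ n)/leP; rewrite ltnn.
have rk B v : B = A \/ B = A^T -> (\rank (krylov B v D.+1) <= D)%N.
  move=> HB; rewrite leqNgt; apply/negP => lt; apply: nPD.
  have fr : row_free (krylov B v D.+1) by rewrite -row_leq_rank.
  by case: HB => E; [left|right]; exists v; rewrite -E.
(* The Gram matrix is invertible of size [D], so both families have rank [D]; by [rk] neither can be
   extended, and [krylov_stable] applies to each. *)
have fin u w : (forall i, (i < D)%N -> (u *m A ^+ i *m w^T) 0 0 = (i.+1 == D)%:R) ->
  [/\ krylov A u D *m (krylov A^T w D)^T \in unitmx,
    (krylov A u D *m A <= krylov A u D)%MS &
    (krylov A^T w D *m A^T <= krylov A^T w D)%MS].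
  move=> Huw.
  have un : krylov A u D *m (krylov A^T w D)^T \in unitmx.
    rewrite krylov_hankel; exact: (hankel_unit Huw).
  have rD : \rank (krylov A u D *m (krylov A^T w D)^T) = D.
    by move: un; rewrite -row_full_unit => /eqP.
  split=> //; apply: krylov_stable; rewrite ?rk; auto.
    rewrite -row_leq_rank -{1}rD; exact: mxrankM_maxl.
  rewrite -row_leq_rank -{1}rD -[X in (_ <= X)%N]mxrank_tr; exact: mxrankM_maxr.
case: PD => -[u fr].
  have [w Hw] := krylov_dual fr; exists D, u, w; have [] := fin u w Hw; split=> //.
have [w Hw] := krylov_dual fr.
(* When the maximal family belongs to [A^T], the roles of [u] and [w] are exchanged by transposing a
   matrix of size 1. *)
have Hw' : forall i, (i < D)%N -> (w *m A ^+ i *m u^T) 0 0 = (i.+1 == D)%:R.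
  move=> i iD; rewrite -Hw // trmxX -[LHS](mxE trmx_key (fun i j => _ j i)).
  by rewrite -/(trmx _) !trmx_mul trmxK mulmxA.
by exists D, w, u; have [] := fin w u Hw'; split.
Qed.

Lemma mxrank_basis (F : fieldType) m n (A : 'M[F]_(m, n)) r : \rank A = r ->
  exists2 B : 'M_(r, n), row_free B & (B :=: A)%MS.
Proof. by move=> <-; exists (row_base A); [exact: row_base_free|exact: eq_row_base]. Qed.

(** Induction on [n]. The span of [K] and the kernel [B] of [Lt^T] are complementary and stable, so
    that [A] becomes block diagonal with blocks [C] and [A']. The Gram matrix [H] intertwines [C]
    with its transpose, and the induction hypothesis deals with [A']. *)
Lemma trmx_similar (F : fieldType) n (A : 'M[F]_n) :
  exists2 G, G \in unitmx & A *m G = G *m A^T.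
Proof.
elim/ltn_ind: n A => n IH A.
have [n0|n0] := posnP n.
  exists 1%:M; first exact: unitmx1.
  move: A {IH}; rewrite n0 => A.
  by rewrite (flatmx0 A) trmx0 mulmx0 mul0mx.
have [D [u [w [D0 Huw un stu stw]]]] := krylov_pair A n0.
set K := krylov A u D in un stu *; set Lt := krylov A^T w D in un stw *.
have /submxP[C EC] := stu; have /submxP[C' EC'] := stw.
have rL : \rank Lt^T = D.
  apply/eqP; rewrite eqn_leq mxrank_tr rank_leq_row /=.
  move: un; rewrite -row_full_unit => /eqP {1}<-.
  by rewrite -[X in (_ <= X)%N]mxrank_tr mxrankM_maxr.
have Dn : (D <= n)%N by rewrite -rL mxrank_tr rank_leq_col.
have [n' En] : exists n', n = (D + n')%N by exists (n - D)%N; rewrite subnKC.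
subst n.
have rk : \rank (kermx Lt^T) = n' by rewrite mxrank_ker rL addKn.
have [B frB EB] := mxrank_basis rk.
have BL : B *m Lt^T = 0 by apply/sub_kermxP; rewrite EB.
have stB : (B *m A <= B)%MS.
  rewrite EB; apply/sub_kermxP; rewrite -mulmxA.
  have -> : A *m Lt^T = Lt^T *m C'^T by rewrite -trmx_mul -EC' trmx_mul trmxK.
  by rewrite mulmxA BL mul0mx.
have /submxP[A' EA'] := stB.
have [|G' uG' EG'] := IH n' _ A'; first by rewrite -[X in (X < _)%N]add0n ltn_add2r.
set H := K *m Lt^T in un.
(* [C *m H] is the Gram matrix of the family started at [u *m A]. It is again Hankel, hence
   symmetric, as is [H]; transposing the product gives the claim. *)
have CH : C *m H = H *m C^T.
  have sH : H^T = H.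
    by rewrite /H krylov_hankel; apply/matrixP=> i j;
      rewrite [LHS]mxE [LHS]mxE [RHS]mxE (addnC (nat_of_ord j)).
  have E1 : C *m H = K *m A *m Lt^T by rewrite EC !mulmxA.
  have sKA : (K *m A *m Lt^T)^T = K *m A *m Lt^T.
    have -> : K *m A = krylov A (u *m A) D.
      apply/row_matrixP=> i; rewrite row_mul !row_krylov -!mulmxA.
      by rewrite -[A ^+ i *m A]/(A ^+ i * A) -exprSr exprS.
    by rewrite krylov_hankel; apply/matrixP=> i j;
      rewrite [LHS]mxE [LHS]mxE [RHS]mxE (addnC (nat_of_ord j)).
  by rewrite -[RHS]trmxK trmx_mul trmxK sH E1 sKA.
pose P := col_mx K B; pose Q := block_mx C 0 0 A'.
have PA : P *m A = Q *m P.
  by rewrite mul_col_mx mul_block_col !mul0mx addr0 add0r EC EA'.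
have uP : P \in unitmx.
  rewrite -row_free_unit; apply/inj_row_free => x.
  rewrite -[x]hsubmxK mul_row_col => E0.
  have E1 : lsubmx x = 0.
    move/(congr1 (mulmx^~ Lt^T)): E0; rewrite mulmxDl -!mulmxA BL mulmx0 addr0 mul0mx.
    by rewrite -/H => /(congr1 (mulmx^~ (invmx H))); rewrite mulmxK // mul0mx.
  move: E0; rewrite E1 mul0mx add0r => /eqP.
  by rewrite mulmx_free_eq0 // => /eqP ->; rewrite row_mx0.
pose S := block_mx H 0 0 G'.
have QS : Q *m S = S *m Q^T.
  rewrite tr_block_mx !trmx0 !mulmx_block !mul0mx !mulmx0 !addr0 !add0r CH EG' //.
have uS : S \in unitmx by rewrite unitmxE det_lblock unitrM -!unitmxE un.
have AP : A *m invmx P = invmx P *m Q.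
  by apply: (can_inj (mulKmx uP)); rewrite !mulmxA PA mulmxK // mulmxV // mul1mx.
(* An intertwiner between a matrix and its transpose is a bilinear form, so the change of basis acts
   on it by congruence and not by conjugation. *)
exists (invmx P *m S *m (invmx P)^T).
  by rewrite !unitmx_mul unitmx_tr unitmx_inv uP uS.
rewrite !mulmxA AP -(mulmxA _ Q) QS -!mulmxA; congr (_ *m (_ *m _)).
by rewrite -!trmx_mul AP.
Qed.

(* Dualise the quotient and use that a matrix is similar to its transpose. *)
Lemma quotient_embeds (F : fieldType) w t (A : 'M[F]_w) (B : 'M_t)
    (Q : 'M_(w, t)) : row_full Q -> A *m Q = Q *m B ->
  exists2 E : 'M_(t, w), row_free E & B *m E = E *m A.
Proof.
move=> fQ AQ.
have [G uG EG] := trmx_similar B; have [H uH EH] := trmx_similar A.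
exists (G *m Q^T *m invmx H).
  rewrite /row_free mxrankMfree ?row_free_unit ?unitmx_inv //.
  by rewrite (eqmxMfull (Q^T)) ?row_full_unit // mxrank_tr.
have AH : A^T *m invmx H = invmx H *m A.
  by apply: (can_inj (mulKmx uH)); rewrite !mulmxA -EH mulmxK // mulmxV // mul1mx.
rewrite !mulmxA EG -(mulmxA G B^T) -trmx_mul -AQ trmx_mul -!mulmxA AH //.
Qed.


(* By Cayley-Hamilton the powers of A are values at A of distinct nonzero
   polynomials of size at most d. *)
Lemma order_bound (k : finFieldType) d (A : 'M[k]_d) r : (0 < d)%N ->
  A \in unitmx -> (forall s, (0 < s < r)%N -> A ^+ s != 1%:M) ->
  (r <= #|k| ^ d - 1)%N.
Proof.
case: d A => // d A _ uA Hr.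
pose f (i : 'I_r) : 'rV_d.+1 := poly_rV ('X^i %% char_poly A).
have cn0 : char_poly A != 0 by rewrite -size_poly_eq0 size_char_poly.
have fA i : horner_mx A (rVpoly (f i)) = A ^+ i.
  rewrite poly_rV_K; last first.
    by rewrite -ltnS -(size_char_poly A) ltn_modp.
  have -> : A ^+ i = horner_mx A 'X^i by rewrite rmorphXn /= horner_mx_X.
  rewrite {2}(divp_eq 'X^i (char_poly A)) rmorphD rmorphM /= Cayley_Hamilton.
  by rewrite mulr0 add0r.
have uX i : A ^+ i \is a GRing.unit by apply: unitrX.
have f0 i : f i != 0.
  apply/eqP => E; have := uX i; rewrite -fA E linear0 rmorph0.
  by rewrite unitr0.
have finj : injective f.
  have wl (i j : 'I_r) : (i <= j)%N -> f i = f j -> i = j.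
    move=> lij /(congr1 (fun x => horner_mx A (rVpoly x))).
    rewrite !fA -(subnK lij) exprD -{1}[A ^+ i]mul1r => /(mulIr (uX i)) E.
    apply/val_inj/eqP; rewrite eqn_leq lij /= leqNgt; apply/negP => lt.
    have := Hr (j - i)%N; rewrite -E subn_gt0 lt (leq_ltn_trans (leq_subr _ _)) //.
    by rewrite eqxx => /(_ isT).
  move=> i j; case: (leqP i j) => [/wl //|/ltnW/wl H /esym/H //].
have : (#|codom f| <= #|[set~ (0%R : 'rV[k]_d.+1)]|)%N.
  by apply/subset_leq_card/subsetP => x /codomP[i ->]; rewrite !inE; apply: f0.
by rewrite card_codom // card_ord cardsC1 card_mx mul1n subn1.
Qed.

(** * Sequences over a discrete valuation ring *)

(** The last clause says that the topology defined by the powers of [pi] is separated: congruences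
    modulo all powers prove an equality. *)
Definition uniformizer (R : idomainType) (pi : R) : Prop :=
  [/\ pi \isn't a GRing.unit,
      forall x, x \isn't a GRing.unit -> exists y, x = pi * y
    & forall x, (forall c, exists y, x = pi ^+ c * y) -> x = 0].

(** An element of valuation 1 works: [R] is the set of elements of nonnegative valuation, so the
    units have valuation 0 and every nonunit can be divided by [pi]. *)
Lemma dvr_uniformizer (R : idomainType) (v : {fraction R} -> int) :
  complete_dvr v -> exists pi : R, uniformizer pi.
Proof.
move=> [[vM _ [pi' pi0 vpi]] vR _].
have [pi Epi] : exists a, pi' = tofrac a by apply/vR; rewrite ?vpi.
have tf (x : R) : (tofrac x == 0) = (x == 0) by rewrite tofrac_eq0.
have v1 : v 1 = 0.
  have := vM 1 1 (oner_neq0 _) (oner_neq0 _); rewrite mulr1 => /eqP.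
  by rewrite -subr_eq0 opprD addrA subrr sub0r oppr_eq0 => /eqP.
have vn x : x != 0 -> v (tofrac x) >= 0 by move=> x0; apply/vR; [rewrite tf|exists x].
have vu (x : R) : x != 0 -> v (tofrac x) = 0 -> x \is a GRing.unit.
  move=> x0 vx0; have x0' : tofrac x != 0 by rewrite tf.
  have : 0 <= v (tofrac x)^-1.
    have := vM _ _ x0' (invr_neq0 x0'); rewrite mulfV // v1 vx0 add0r => <- //.
  move/(vR _ (invr_neq0 x0')) => [y Ey]; apply/unitrP; exists y.
  have E : x * y = 1.
    by apply/eqP; rewrite -tofrac_eq tofracM -Ey mulfV ?tofrac1.
  by rewrite mulrC E.
have pi0R : pi != 0 by rewrite -tf -Epi.
have vX c : v (tofrac (pi ^+ c)) = c%:Z.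
  elim: c => [|c IH]; first by rewrite expr0 tofrac1.
  by rewrite exprS tofracM vM ?tf ?expf_neq0 // IH -Epi vpi intS.
exists pi; split.
- apply/negP => /unitrP[y [Ey _]].
  have y0 : y != 0 by apply/eqP => E; move/eqP: Ey; rewrite E mul0r eq_sym oner_eq0.
  have := vM (tofrac y) (tofrac pi); rewrite !tf -tofracM Ey tofrac1 v1 -Epi vpi.
  by move=> /(_ y0 pi0R); have := vn y y0; lia.
- move=> x nu; have [->|x0] := eqVneq x 0; first by exists 0; rewrite mulr0.
  have x0' : tofrac x != 0 by rewrite tf.
  have vx := vn x x0; have nv : v (tofrac x) <> 0 by move/(vu x x0); apply/negP.
  have q0 : tofrac x / pi' != 0 by rewrite mulf_neq0 ?invr_neq0.
  have Ex : tofrac x / pi' * pi' = tofrac x by rewrite divfK.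
  have : 0 <= v (tofrac x / pi') by have := vM _ _ q0 pi0; rewrite Ex vpi; lia.
  move/(vR _ q0) => [y Ey]; exists y; apply/eqP.
  by rewrite -tofrac_eq tofracM -Epi -Ey mulrC Ex.
- move=> x H; apply/eqP; apply: contraT => x0.
  (* This exponent exceeds the valuation of [x], which no nonzero multiple of that power of [pi] can
     have. *)
  have [y Ey] := H `|v (tofrac x)|%N.+1.
  have y0 : y != 0 by apply: contra_neq x0; rewrite Ey => ->; rewrite mulr0.
  have := vM (tofrac (pi ^+ `|v (tofrac x)|%N.+1)) (tofrac y).
  rewrite -tofracM -Ey !tf vX expf_neq0 // => /(_ isT y0).
  by have := vn y y0; lia.
Qed.

Definition dvd_pow (R : idomainType) (pi : R) c (x : R) := exists y, x = pi ^+ c * y.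

Section DvdPow.
Variables (R : idomainType) (pi : R).
Local Notation dvd := (dvd_pow pi).

Lemma dvd_pow0 x : dvd 0 x.
Proof. by exists x; rewrite expr0 mul1r. Qed.

Lemma dvd_powD c x y : dvd c x -> dvd c y -> dvd c (x + y).
Proof. by move=> [a ->] [b ->]; exists (a + b); rewrite mulrDr. Qed.

Lemma dvd_powM c c' x y : dvd c x -> dvd c' y -> dvd (c + c') (x * y).
Proof. by move=> [a ->] [b ->]; exists (a * b); rewrite exprD mulrACA. Qed.

Lemma dvd_pow_sum c I (r : seq I) (x : I -> R) :
  (forall i, dvd c (x i)) -> dvd c (\sum_(i <- r) x i).
Proof.
move=> H; apply: big_ind => //; last exact: dvd_powD.
by exists 0; rewrite mulr0.
Qed.

(* A sequence in N^2 + pi A, where N is the ideal of the sequences in A with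
   values in (pi). *)
Definition decomposable (A : (nat -> R) -> Prop) (g : nat -> R) :=
  exists l (a b : 'I_l -> nat -> R) h,
    [/\ forall j, A (a j) /\ forall i, dvd 1 (a j i),
        forall j, A (b j) /\ forall i, dvd 1 (b j i), A h
      & forall i, g i = \sum_j a j i * b j i + pi * h i].

(** A twisted Leibniz rule: the difference of a product [a * b] is a sum of products of a
    difference, divisible by [pi ^+ c], and a value divisible by [pi]. The term [pi * h] gains its
    factor directly. *)
Lemma decomposable_shift A g s c :
    (forall f, A f -> forall i, dvd c (f (i + s)%N - f i)) ->
  decomposable A g -> forall i, dvd c.+1 (g (i + s)%N - g i).
Proof.
move=> H [l [a [b [h [Ha Hb Ah Eg]]]]] i; rewrite !Eg opprD addrACA -mulrBr -sumrB.
apply: dvd_powD; last first.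
  by rewrite -add1n; apply: dvd_powM; [exists 1; rewrite mulr1|exact: H].
apply: dvd_pow_sum => j; have [Aa da] := Ha j; have [Ab db] := Hb j.
have -> : a j (i + s)%N * b j (i + s)%N - a j i * b j i =
   (a j (i + s)%N - a j i) * b j (i + s)%N + a j i * (b j (i + s)%N - b j i) by ring.
apply: dvd_powD; first by rewrite -addn1; apply: dvd_powM; [exact: H|].
by rewrite -add1n; apply: dvd_powM; [|exact: H].
Qed.

(** The divisibility of the differences by [pi ^+ c] is raised by one at each step of an induction
    on [c]; separatedness then makes the differences zero. *)
Lemma shift_invariant (A : (nat -> R) -> Prop) s t :
    uniformizer pi -> (t%:R : R) \is a GRing.unit ->
    (forall g, A g -> A (fun i => g i - g 0%N) /\ forall i, dvd 1 (g i - g 0%N)) ->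
    (forall g, A g -> (forall i, dvd 1 (g i)) ->
       decomposable A (fun i => g (i + s)%N - g i)) ->
    (forall g, A g -> forall i, g (i + t * s)%N = g i) ->
  forall g, A g -> forall i, g (i + s)%N = g i.
Proof.
move=> [_ _ sep] ut A0 Adec per g Ag i; apply/eqP; rewrite -subr_eq0; apply/eqP/sep => c.
rewrite -/(dvd c _); elim: c g Ag i => [|c IH] g Ag i; first exact: dvd_pow0.
(* Subtracting the constant [g 0] keeps the differences and makes all values divisible by [pi]. *)
wlog N : g Ag / forall i, dvd 1 (g i).
  move=> H; have [Ag0 Ng0] := A0 g Ag; have := H _ Ag0 Ng0.
  by congr dvd; ring.
pose d i := g (i + s)%N - g i.
have Hd := decomposable_shift IH (Adec g Ag N).
rewrite -/(d i).
have Hj j : dvd c.+1 (d (i + j * s)%N - d i).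
  elim: j => [|j IHj]; first by exists 0; rewrite mulr0 mul0n addn0 subrr.
  have := dvd_powD (Hd (i + j * s)%N) IHj; congr dvd; rewrite addrA subrK.
  by rewrite /d mulSnr addnA.
have S0 : \sum_(j < t) d (i + j * s)%N = 0.
  rewrite -(big_mkord xpredT (fun j => d (i + j * s)%N)) (eq_bigr
    (fun j => g (i + j.+1 * s)%N - g (i + j * s)%N)); last first.
    by move=> j _; rewrite /d mulSnr addnA.
  by rewrite telescope_sumr // per // mul0n addn0 subrr.
(* The [d (i + j * s)] telescope to a sum 0 over the period [t * s], so this sum equals [- t * d i],
   where [t] is a unit. *)
have : dvd c.+1 (\sum_(j < t) (d (i + j * s)%N - d i)) by apply: dvd_pow_sum.
rewrite sumrB S0 sumr_const card_ord sub0r => -[y Ey].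
exists (- (t%:R^-1 * y)).
apply: (mulrI ut); rewrite mulrN mulrN mulrCA mulVKr // -Ey opprK mulr_natl //.
Qed.

(** The induction of [shift_invariant] with shift 1. Here [g - g 0] itself is decomposable, so no
    averaging over a period is required. *)
Lemma constant_of_decomposable (A : (nat -> R) -> Prop) :
    uniformizer pi ->
    (forall g, A g -> A (fun i => g i - g 0%N) /\ forall i, dvd 1 (g i - g 0%N)) ->
    (forall g, A g -> (forall i, dvd 1 (g i)) -> decomposable A g) ->
  forall g, A g -> forall i, g i.+1 = g i.
Proof.
move=> [_ _ sep] A0 Adec g Ag i; apply/eqP; rewrite -subr_eq0; apply/eqP/sep => c.
rewrite -/(dvd c _); elim: c g Ag i => [|c IH] g Ag i; first exact: dvd_pow0.
have [Ag0 Ng0] := A0 g Ag.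
have IH1 f : A f -> forall i, dvd c (f (i + 1)%N - f i).
  by move=> Af j; rewrite addn1; apply: IH.
have := decomposable_shift IH1 (Adec _ Ag0 Ng0) i; rewrite addn1.
by congr dvd; ring.
Qed.

End DvdPow.

(** * Forms and lines *)

Lemma mevalX_scale (A : comNzRingType) n (u : A) (a : 'I_n -> A) (m : 'X_{1..n}) :
  'X_[m].@[fun i => u * a i] = u ^+ mdeg m * 'X_[m].@[a].
Proof.
rewrite !mevalX mdegE -prodrXr -big_split /=; apply: eq_bigr => i _.
by rewrite exprMn.
Qed.

Lemma meval_homog_scale (A : comNzRingType) n e (f : {mpoly A[n]}) u a :
  f \is e.-homog -> f.@[fun i => u * a i] = u ^+ e * f.@[a].
Proof.
move/dhomogP => Hf; rewrite [f]mpolyE !raddf_sum mulr_sumr /=.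
rewrite big_seq [RHS]big_seq; apply: eq_bigr => m /Hf em.
by rewrite !mevalZ mevalX_scale em mulrCA.
Qed.

Lemma dhomog_comp (A : comNzRingType) n l e d (f : {mpoly A[n]})
    (G : n.-tuple {mpoly A[l]}) :
  f \is e.-homog -> (forall i, tnth G i \is d.-homog) ->
  f \mPo G \is (d * e).-homog.
Proof.
move/dhomogP => Hf HG; rewrite comp_mpolyE big_seq; apply: rpred_sum => m /Hf em.
have {}em : mdeg m = e by []; apply: rpredZ; rewrite -em mdegE big_distrr /=.
apply: (big_ind2 (fun q D => q \is D.-homog)).
- exact: dhomog1.
- by move=> q D q' D' Hq Hq'; apply: dhomogM.
- by move=> i _; apply: dhomogMn.
Qed.

Lemma map_mpoly_homog (A B : comNzRingType) (f : {rmorphism A -> B}) n e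
    (q : {mpoly A[n]}) : q \is e.-homog -> map_mpoly f q \is e.-homog.
Proof.
move/dhomogP => Hq; rewrite [q]mpolyE (raddf_sum (map_mpoly f)) /= big_seq.
apply: rpred_sum => m /Hq em.
by rewrite map_mpolyZ map_mpolyX; apply: rpredZ; rewrite dhomogX em.
Qed.

Lemma map_mpoly_pihomog (A B : comNzRingType) (f : {rmorphism A -> B}) n e
    (q : {mpoly A[n]}) :
  map_mpoly f (pihomog mdeg e q) = pihomog mdeg e (map_mpoly f q).
Proof.
rewrite {1}/pihomog raddf_sum big_mkcond /= [in RHS](mpolyE q).
rewrite (raddf_sum (map_mpoly f)) (raddf_sum (pihomog mdeg e)) /=.
apply: eq_bigr => m _ /=.
rewrite map_mpolyZ map_mpolyX linearZ /= pihomogX.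
by case: ifP => _; rewrite ?scaler0.
Qed.

Lemma map_mpoly_eval (A B : comNzRingType) (f : {rmorphism A -> B}) n
    (q : {mpoly A[n]}) a : (map_mpoly f q).@[f \o a] = f q.@[a].
Proof.
rewrite [q]mpolyE (raddf_sum (map_mpoly f)) (raddf_sum (meval (f \o a))).
rewrite (raddf_sum (meval a)) (raddf_sum f) /=; apply: eq_bigr => m _.
rewrite map_mpolyZ map_mpolyX !mevalZ !mevalX rmorphM rmorph_prod /=.
by congr (_ * _); apply: eq_bigr => i _; rewrite rmorphXn.
Qed.

Lemma map_mpoly_mPo (A B : comNzRingType) (f : {rmorphism A -> B}) n l
    (q : {mpoly A[n]}) (G : n.-tuple {mpoly A[l]}) :
  map_mpoly f (q \mPo G) = map_mpoly f q \mPo map_tuple (map_mpoly f) G.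
Proof.
rewrite [q]mpolyE (raddf_sum (comp_mpoly G)) (raddf_sum (map_mpoly f)).
rewrite (raddf_sum (map_mpoly f)) (raddf_sum (comp_mpoly _)) /=; apply: eq_bigr => m _.
rewrite map_mpolyZ map_mpolyX !comp_mpolyZ map_mpolyZ !comp_mpolyX rmorph_prod /=.
by congr (_ *: _); apply: eq_bigr => i _; rewrite rmorphXn tnth_map.
Qed.

Lemma map_mpoly_mderiv (A B : comNzRingType) (f : {rmorphism A -> B}) n i
    (q : {mpoly A[n]}) : map_mpoly f q^`M(i) = (map_mpoly f q)^`M(i).
Proof.
apply/mpolyP => m; rewrite mcoeff_map_mpoly !mcoeff_deriv mcoeff_map_mpoly.
by rewrite raddfMn.
Qed.

Lemma map_mpoly_surj (A B : comNzRingType) (f : {rmorphism A -> B}) n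
    (q : {mpoly B[n]}) : (forall y, exists x, f x = y) ->
  exists q', map_mpoly f q' = q.
Proof.
move=> fs; elim/mpolyind: q => [|c m q _ _ [q' Hq']]; first by exists 0; rewrite raddf0.
have [c' Hc'] := fs c; exists (c' *: 'X_[m] + q').
by rewrite raddfD /= map_mpolyZ map_mpolyX Hc' Hq'.
Qed.

Lemma map_mpoly_homog_surj (A B : comNzRingType) (f : {rmorphism A -> B}) n e
    (q : {mpoly B[n]}) : (forall y, exists x, f x = y) -> q \is e.-homog ->
  exists2 q', q' \is e.-homog & map_mpoly f q' = q.
Proof.
move=> fs Hq; have [q' Hq'] := map_mpoly_surj q fs.
exists (pihomog mdeg e q'); first exact: pihomogP.
by rewrite map_mpoly_pihomog Hq' pihomog_dE.
Qed.

Lemma mderiv_homog (A : comNzRingType) n e i (q : {mpoly A[n]}) :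
  q \is e.-homog -> q^`M(i) \is e.-1.-homog.
Proof.
move/dhomogP => Hq; rewrite [q]mpolyE raddf_sum /= big_seq.
apply: rpred_sum => m /Hq em; rewrite linearZ /= mderivX; apply: rpredZ.
have [->|mi] := eqVneq (m i) 0%N; first by rewrite scale0r dhomog0.
apply: rpredZ; rewrite dhomogX -em; apply/eqP.
have le : (U_(i) <= m)%MM by rewrite lep1mP.
have := mdegD (m - U_(i)) U_(i); rewrite (submK le) mdeg1 addn1 => E.
by rewrite -[X in _ = X.-1]/(mdeg m) E.
Qed.

(* The restriction of f to the line through a. *)
Definition ray (A : comNzRingType) n (a : 'I_n -> A) (f : {mpoly A[n]}) : {poly A} :=
  mmap polyC (fun i => a i *: 'X) f.

HB.instance Definition _ (A : comNzRingType) n (a : 'I_n -> A) :=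
  GRing.RMorphism.copy (ray a) (mmap polyC (fun i => a i *: 'X)).

Lemma ray_monomial (A : comNzRingType) n (a : 'I_n -> A) c (m : 'X_{1..n}) :
  ray a (c *: 'X_[m]) = (c * 'X_[m].@[a]) *: 'X^(mdeg m).
Proof.
rewrite /ray mmapZ mmapX /mmap1 mevalX mul_polyC mdegE -scalerA; congr (_ *: _).
rewrite -prodrXr -scaler_prod; apply: eq_bigr => i _.
by rewrite exprZn.
Qed.

Lemma coef_ray (A : comNzRingType) n (a : 'I_n -> A) f e :
  (ray a f)`_e = (pihomog mdeg e f).@[a].
Proof.
rewrite [in LHS](mpolyE f) /pihomog (raddf_sum (ray a)) (raddf_sum (meval a)) /=.
rewrite coef_sum [RHS]big_mkcond /=.
apply: eq_bigr => m _; rewrite ray_monomial coefZ coefXn eq_sym.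
by case: ifP => _; rewrite ?mevalZ ?mulr1 ?mulr0.
Qed.

Lemma ray_eq0 (A : comNzRingType) n (a : 'I_n -> A) f :
  ray a f = 0 <-> forall e, (pihomog mdeg e f).@[a] = 0.
Proof.
split=> [E e|H]; first by rewrite -coef_ray E coef0.
by apply/polyP => e; rewrite coef_ray H coef0.
Qed.

Lemma ray_homog (A : comNzRingType) n (a : 'I_n -> A) e f : f \is e.-homog ->
  ray a f = f.@[a] *: 'X^e.
Proof.
move=> Hf; apply/polyP => d; rewrite coef_ray coefZ coefXn.
have [->|ne] := eqVneq d e; first by rewrite pihomog_dE // mulr1.
by rewrite (pihomog_ne0 (d := e)) 1?eq_sym // meval0 mulr0.
Qed.

Lemma ray_homog_eq0 (A : comNzRingType) n (a : 'I_n -> A) e f : f \is e.-homog ->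
  (ray a f = 0) <-> (f.@[a] = 0).
Proof.
move=> Hf; rewrite (ray_homog _ Hf); split=> [/polyP/(_ e)|->]; last by rewrite scale0r.
by rewrite coefZ coefXn eqxx mulr1 coef0.
Qed.

Lemma meval_ray0 (A : comNzRingType) n (a : 'I_n -> A) f : ray a f = 0 -> f.@[a] = 0.
Proof.
move/ray_eq0 => H; rewrite (@pihomog_partitionE _ _ mdeg _ f (leqnn _)) raddf_sum /=.
by rewrite big1.
Qed.

(** The homogeneous ideal of the point [f \o a], written as the kernel of a ring morphism to
    polynomials in one variable. It is thus prime as soon as [B] is a domain, and the coefficients
    on the line are the values of the homogeneous components. *)
Definition point_ideal (A B : comNzRingType) (f : {rmorphism A -> B}) n
  (a : 'I_n -> A) (q : {mpoly A[n]}) : Prop := ray (f \o a) (map_mpoly f q) = 0.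

Lemma is_point_ideal (A : comNzRingType) (B : idomainType) (f : {rmorphism A -> B})
    N (I : {mpoly A[N.+1]} -> Prop) (a : 'I_N.+1 -> A) i :
  (forall q, I q -> point_ideal f a q) -> f (a i) != 0 -> is_point I (point_ideal f a).
Proof.
move=> Iv ai; split=> //.
- split; first split.
  + by rewrite /point_ideal !rmorph0.
  + by move=> q r; rewrite /point_ideal !rmorphD /= => -> ->; rewrite addr0.
  + by move=> q r; rewrite /point_ideal !rmorphM /= => ->; rewrite mulr0.
  move=> e q; rewrite /point_ideal => /ray_eq0 H.
  apply/(@ray_homog_eq0 _ _ _ e); last by rewrite map_mpoly_pihomog H.
  exact/map_mpoly_homog/pihomogP.
- move=> q r; rewrite /point_ideal !rmorphM /= => /eqP.
  by rewrite mulf_eq0 => /orP[] /eqP; auto.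
- exists i; rewrite /point_ideal map_mpolyX => /meval_ray0; rewrite mevalXU.
  by apply/eqP.
Qed.

Lemma point_ideal_vanish (A B : comNzRingType) (f : {rmorphism A -> B}) N
    (I : {mpoly A[N.+1]} -> Prop) (a : 'I_N.+1 -> A) q :
    homogeneous_ideal I -> (forall q e, I q -> q \is e.-homog -> q.@[a] = 0) ->
  I q -> point_ideal f a q.
Proof.
move=> [_ hI] Iv Iq; apply/ray_eq0 => e.
by rewrite -map_mpoly_pihomog map_mpoly_eval (Iv _ e) ?rmorph0 //;
  [exact: hI|exact: pihomogP].
Qed.

Lemma point_idealE (A B : comNzRingType) (f : {rmorphism A -> B}) n e
    (a : 'I_n -> A) (q : {mpoly A[n]}) :
  q \is e.-homog -> point_ideal f a q <-> f q.@[a] = 0.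
Proof.
move=> Hq; rewrite /point_ideal (ray_homog_eq0 _ (map_mpoly_homog f Hq)).
by rewrite map_mpoly_eval.
Qed.

(** * Orbits of points *)

Lemma same_point_refl (A : comUnitRingType) N (a : 'I_N.+1 -> A) : same_point a a.
Proof. by exists 1; [exact: unitr1|move=> i; rewrite mul1r]. Qed.

Lemma same_point_sym (A : comUnitRingType) N (a b : 'I_N.+1 -> A) :
  same_point a b -> same_point b a.
Proof.
by move=> [u uu E]; exists u^-1; [rewrite unitrV|move=> i; rewrite E mulKr].
Qed.

Lemma same_point_trans (A : comUnitRingType) N (a b c : 'I_N.+1 -> A) :
  same_point a b -> same_point b c -> same_point a c.
Proof.
move=> [u uu Eb] [w uw Ec]; exists (w * u); first by rewrite unitrM uw.
by move=> i; rewrite Ec Eb mulrA.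
Qed.

Lemma same_point_ext (A : comUnitRingType) N (a b : 'I_N.+1 -> A) :
  a =1 b -> same_point a b.
Proof. by move=> E; exists 1; [exact: unitr1|move=> i; rewrite mul1r E]. Qed.

Lemma same_point_unimodular (A : comUnitRingType) N (a b : 'I_N.+1 -> A) :
  same_point a b -> unimodular a -> unimodular b.
Proof. by move=> [u uu E] [i ui]; exists i; rewrite E unitrM uu. Qed.

Lemma same_point_map (A B : comUnitRingType) (f : {rmorphism A -> B}) N
    (a b : 'I_N.+1 -> A) : same_point a b -> same_point (f \o a) (f \o b).
Proof.
move=> [u uu E]; exists (f u); first exact: rmorph_unit.
by move=> i /=; rewrite E rmorphM.
Qed.

Definition homog_tuple (A : comNzRingType) N (F : N.+1.-tuple {mpoly A[N.+1]}) :=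
  exists e, forall i, tnth F i \is e.-homog.

Lemma meval_same_point (A : comUnitRingType) N e (f : {mpoly A[N.+1]})
    (a b : 'I_N.+1 -> A) : same_point a b -> f \is e.-homog ->
  exists2 u, u \is a GRing.unit & f.@[b] = u * f.@[a].
Proof.
move=> [u uu E] Hf; exists (u ^+ e); first exact: unitrX.
by rewrite (meval_eq _ E) (meval_homog_scale _ _ Hf).
Qed.

Lemma same_point_chart (A : comUnitRingType) N (F : N.+1.-tuple {mpoly A[N.+1]})
    (a b : 'I_N.+1 -> A) : homog_tuple F -> same_point a b ->
  same_point (chart_eval F a) (chart_eval F b).
Proof.
move=> [e HF] [u uu E]; exists (u ^+ e); first exact: unitrX.
by move=> i; rewrite /chart_eval (meval_eq _ E) (meval_homog_scale _ _ (HF i)).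
Qed.

Lemma chart_comp_homog (A : comNzRingType) N (J : Type) (phi : charts J A N) s :
  (forall j, homog_tuple (phi j)) -> homog_tuple (chart_comp phi s).
Proof.
move=> H; elim: s => [|j s [d IH]] /=.
  by exists 1%N => i; rewrite tnth_mktuple dhomogX /= mdeg1.
have [e He] := H j; exists (d * e)%N => i; rewrite tnth_mktuple.
exact: dhomog_comp.
Qed.

Lemma chart_eval_comp (A : comNzRingType) N (J : Type) (phi : charts J A N) j s a :
  chart_eval (chart_comp phi (j :: s)) a =1
  chart_eval (phi j) (chart_eval (chart_comp phi s) a).
Proof. by move=> i; rewrite /chart_eval /= tnth_mktuple comp_mpoly_meval. Qed.

Lemma chart_comp_map (A B : comNzRingType) (f : {rmorphism A -> B}) N (J : Type)
    (phi : charts J A N) s :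
  chart_comp (charts_base_change f phi) s = map_tuple (map_mpoly f) (chart_comp phi s).
Proof.
apply: eq_from_tnth => i; rewrite tnth_map.
elim: s i => [|j s IH] i /=; rewrite !tnth_mktuple ?map_mpolyX //.
rewrite tnth_map map_mpoly_mPo; congr (_ \mPo _).
by apply: eq_from_tnth => l; rewrite IH tnth_map.
Qed.

Lemma chart_eval_map (A B : comNzRingType) (f : {rmorphism A -> B}) N
    (F : N.+1.-tuple {mpoly A[N.+1]}) a :
  chart_eval (map_tuple (map_mpoly f) F) (f \o a) =1 f \o chart_eval F a.
Proof. by move=> i; rewrite /chart_eval tnth_map map_mpoly_eval. Qed.

(** A translation-invariant equivalence on the natural numbers is a congruence; its modulus is the
    least positive number equivalent to 0. It serves both for the orbit and for the reduced
    orbit. *)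
Lemma period_mod (E : nat -> nat -> Prop) n :
    (forall i, E i i) -> (forall i j, E i j -> E j i) ->
    (forall i j l, E i j -> E j l -> E i l) ->
    (forall i j l, E i j -> E (i + l)%N (j + l)%N) ->
    (0 < n)%N -> E 0%N n -> (forall s, (0 < s < n)%N -> ~ E 0%N s) ->
  forall i j, E i j <-> i = j %[mod n].
Proof.
move=> refl sym trans shift n0 En min.
have per c i : E i (i + c * n)%N.
  elim: c => [|c IH]; first by rewrite mul0n addn0.
  apply: trans IH _; have := shift _ _ (i + c * n)%N En; rewrite add0n.
  by rewrite (_ : (n + (i + c * n) = i + c.+1 * n)%N) // mulSn addnCA.
have Em i : E i (i %% n)%N by apply: sym; rewrite {2}(divn_eq i n) addnC.
have E0 s : (s < n)%N -> E 0%N s -> s = 0%N.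
  by case: s => // s lt /min; rewrite lt => /(_ isT).
move=> i j; split=> [Eij|Eij]; last first.
  by apply: trans (Em i) _; rewrite Eij; apply/sym/Em.
suff wl a b : (a <= b)%N -> (b < n)%N -> E a b -> a = b.
  have Emm : E (i %% n)%N (j %% n)%N.
    by apply: (trans _ _ _ _ (Em j)); apply: (trans _ _ _ _ Eij); apply/sym/Em.
  case: (leqP (i %% n) (j %% n)) => [le|/ltnW le]; first by apply: wl; rewrite ?ltn_mod.
  by apply/esym/wl; rewrite ?ltn_mod //; apply: sym.
move=> le lt Eab.
have : E 0%N (b - a)%N.
  (* Subtraction is replaced by the translation by [n - a], which carries [a] to [n] and [b] to
     [b - a + n]. *)
  have := shift _ _ (n - a)%N Eab; rewrite subnKC; last first.
    by apply: ltnW; apply: leq_ltn_trans lt.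
  have -> : (b + (n - a) = b - a + n)%N by lia.
  move=> H; apply: (trans _ _ _ En); apply: (trans _ _ _ H); apply: sym.
  by have := per 1%N (b - a)%N; rewrite mul1n.
by move/E0 => H; apply/eqP; rewrite eqn_leq le -subn_eq0 H //; lia.
Qed.

Section Orbit.
Variables (R : idomainType) (k : fieldType) (rho : {rmorphism R -> k}).
Hypothesis hk : residue_map rho.
Variables (N : nat) (X : {mpoly R[N.+1]} -> Prop).
Hypothesis hX : homogeneous_ideal X.
Variables (J : Type) (phi : charts J R N).
Hypothesis hphi : endomorphism X phi.

Lemma unit_residue x : (x \is a GRing.unit) = (rho x != 0).
Proof.
have [_ H] := hk; apply/idP/idP => [u|]; last by apply: contraNT => /H ->.
by apply/eqP => /H; rewrite u.
Qed.

Lemma unimodular_residue (a : 'I_N.+1 -> R) :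
  unimodular (rho \o a) <-> unimodular a.
Proof.
by split=> -[i ui]; exists i; move: ui; rewrite /= unitfE -unit_residue.
Qed.

(** With [i] chosen so that [a i] is a unit, the power of ['X_i * h] takes a unit value at [a] and
    can be cancelled. *)
Lemma zero_on_eval e e' h f a : rational_point X a -> h \is e.-homog ->
  f \is e'.-homog -> zero_on X h f -> h.@[a] \is a GRing.unit -> f.@[a] = 0.
Proof.
move=> [[i ui] Xa] Hh Hf /(_ i)[M XM] uh.
have : (('X_i * h) ^+ M * f).@[a] = 0.
  apply: (Xa _ ((1 + e) * M + e')%N XM); apply: dhomogM => //; apply: dhomogMn.
  by apply: dhomogM => //; rewrite dhomogX /= mdeg1.
rewrite mevalM rmorphXn /= mevalM mevalXU => /eqP; rewrite mulf_eq0 => /orP[|/eqP //].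
have : (a i * h.@[a]) ^+ M \is a GRing.unit by rewrite unitrX // unitrM ui.
by move=> u /eqP E; rewrite E unitr0 in u.
Qed.

Lemma phi_homog j : homog_tuple (phi j).
Proof. by have [H _ _ _] := hphi; apply: H. Qed.

Lemma comp_homog s : homog_tuple (chart_comp phi s).
Proof. exact/chart_comp_homog/phi_homog. Qed.

(** The covering condition is applied to the closed point of the section [a], that is to its
    reduction; a component that is nonzero there is a unit over [R]. *)
Lemma chart_exists a : rational_point X a -> exists j, unimodular (chart_eval (phi j) a).
Proof.
move=> [[i ui] Xa]; have [_ hcov _ _] := hphi.
have [|j [c nc]] := hcov (point_ideal rho a).
  apply: (is_point_ideal (i := i)); last by rewrite -unit_residue.
  by move=> q; apply: point_ideal_vanish.
exists j, c; have [e He] := phi_homog j.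
by rewrite unit_residue; apply/eqP => /(point_idealE rho a (He c)).
Qed.

(** The minors of size 2 of the two image vectors vanish at [a], so the vectors are proportional,
    with a unit as factor. *)
Lemma charts_agree a j j' : rational_point X a ->
  unimodular (chart_eval (phi j) a) -> unimodular (chart_eval (phi j') a) ->
  same_point (chart_eval (phi j) a) (chart_eval (phi j') a).
Proof.
move=> ra [c uc] [c' uc']; have [_ _ hag _] := hphi.
have [e He] := phi_homog j; have [e' He'] := phi_homog j'.
have E s t : chart_eval (phi j) a s * chart_eval (phi j') a t =
             chart_eval (phi j) a t * chart_eval (phi j') a s.
  apply/eqP; rewrite -subr_eq0 /chart_eval -!mevalM -mevalB; apply/eqP.
  apply: (zero_on_eval ra _ _ (hag j j' c c' s t)).
  - by apply: dhomogM.
  - by apply: rpredB; apply: dhomogM.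
  - by rewrite mevalM unitrM; apply/andP.
have uc2 : chart_eval (phi j) a c' \is a GRing.unit.
  have : chart_eval (phi j) a c * chart_eval (phi j') a c' \is a GRing.unit.
    by rewrite unitrM uc.
  by rewrite E unitrM => /andP[].
exists (chart_eval (phi j') a c' / chart_eval (phi j) a c').
  by rewrite unitrM uc' unitrV.
move=> s; apply: (mulrI uc2).
by rewrite (mulrC (chart_eval (phi j') a c')) -mulrA mulVKr // E mulrC.
Qed.

Lemma rational_image a j : rational_point X a ->
  unimodular (chart_eval (phi j) a) -> rational_point X (chart_eval (phi j) a).
Proof.
move=> ra uj; split=> // f e Xf Hf; have [c uc] := uj.
have [_ _ _ him] := hphi; have [d Hd] := phi_homog j.
rewrite -[LHS]/(f.@[fun i => (tnth (phi j) i).@[a]]) -comp_mpoly_meval.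
exact: (zero_on_eval ra (Hd c) (dhomog_comp Hf Hd) (him j c f e Xf Hf)).
Qed.

Variables (P : 'I_N.+1 -> R).
Hypothesis hP : rational_point X P.

(** Points are vectors up to units and [sends] is only a relation. Choice fixes one vector per orbit
    point, so that forms can be evaluated along the orbit. *)
Lemma orbit_exists : exists q : nat -> 'I_N.+1 -> R,
  [/\ q 0%N = P, forall s, rational_point X (q s) & forall s, exists2 j,
      unimodular (chart_eval (phi j) (q s)) & q s.+1 = chart_eval (phi j) (q s)].
Proof.
pose T := {a | rational_point X a}.
have next (a : T) : {b : T | exists2 j,
    unimodular (chart_eval (phi j) (sval a)) & sval b = chart_eval (phi j) (sval a)}.
  apply: constructive_indefinite_description; case: a => a ra /=.
  have [j uj] := chart_exists ra.
  by exists (exist _ _ (rational_image ra uj)), j.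
pose q s := iter s (fun a => sval (next a)) (exist _ P hP : T).
exists (fun s => sval (q s)); split=> // s; first by case: (q s).
by rewrite /q iterS; apply: (svalP (next _)).
Qed.

Variable q : nat -> 'I_N.+1 -> R.
Hypothesis q0 : q 0%N = P.
Hypothesis qX : forall s, rational_point X (q s).
Hypothesis qS : forall s, exists2 j,
  unimodular (chart_eval (phi j) (q s)) & q s.+1 = chart_eval (phi j) (q s).

Lemma orbit_chart_exists i l : exists2 t : seq J, size t = l &
  unimodular (chart_eval (chart_comp phi t) (q i)) /\
  same_point (chart_eval (chart_comp phi t) (q i)) (q (i + l)%N).
Proof.
elim: l => [|l [t st [ut sp]]].
  exists [::] => //; have E : chart_eval (chart_comp phi [::]) (q i) =1 q i.
    by move=> c; rewrite /chart_eval /= tnth_mktuple mevalXU.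
  have [u _] := qX i; rewrite addn0; split; last exact: same_point_ext.
  by have [c uc] := u; exists c; rewrite E.
have [j uj Ej] := qS (i + l)%N; exists (j :: t); rewrite /= ?st //.
have sp1 : same_point (chart_eval (chart_comp phi (j :: t)) (q i)) (q (i + l).+1).
  apply: same_point_trans (same_point_ext (chart_eval_comp _ _ _ _)) _.
  by rewrite Ej; apply: same_point_chart sp; apply: phi_homog.
rewrite addnS; split=> //; apply: same_point_unimodular (same_point_sym sp1) _.
by have [] := qX (i + l).+1.
Qed.

(* A chart of degree 0 is defined at vectors that are not unimodular, but it is
   then constant. *)
Lemma orbit_chart i t : unimodular (chart_eval (chart_comp phi t) (q i)) ->
  same_point (chart_eval (chart_comp phi t) (q i)) (q (i + size t)%N).
Proof.
elim: t => [|j t IH] u.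
  rewrite addn0; apply: same_point_ext => c.
  by rewrite /chart_eval /= tnth_mktuple mevalXU.
set b := chart_eval (chart_comp phi t) (q i) in IH.
have Eb := chart_eval_comp phi j t (q i).
have uj : unimodular (chart_eval (phi j) b).
  by have [c uc] := u; exists c; rewrite -Eb.
rewrite /= addnS; have [j' uj' ->] := qS (i + size t)%N.
apply: same_point_trans (same_point_ext Eb) _; rewrite -/b.
suff sp : same_point (chart_eval (phi j) b) (chart_eval (phi j) (q (i + size t)%N)).
  apply: (same_point_trans sp); apply: charts_agree => //.
  exact: (same_point_unimodular sp).
have [[l ul]|nu] := classic (unimodular b).
  by apply: same_point_chart; [exact: phi_homog|apply: IH; exists l].
have [e He] := phi_homog j.
have b0 l : rho (b l) = 0.
  by apply/eqP; apply: contraT; rewrite -unit_residue => ul; case: nu; exists l.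
(* The reduction of [b] is the zero vector, where every form of positive degree vanishes, whereas
   [phi j] has a unit value at [b]. *)
have e0 : e = 0%N.
  have [c uc] := uj; apply/eqP; apply: contraTT uc => e0; rewrite unit_residue negbK.
  rewrite /chart_eval -map_mpoly_eval.
  rewrite (meval_eq _ (v2 := fun i => 0 * (rho \o b) i)); last first.
    by move=> l; rewrite mul0r /= b0.
  rewrite (meval_homog_scale _ _ (map_mpoly_homog rho (He c))) expr0n.
  by rewrite (negbTE e0) mul0r.
apply: same_point_ext => c; rewrite /chart_eval.
have H0 x : (tnth (phi j) c).@[x] = (tnth (phi j) c).@[fun _ => 0].
  have := meval_homog_scale 0 x (He c); rewrite e0 expr0 mul1r => <-.
  by apply: meval_eq => l; rewrite mul0r.
by rewrite !H0.
Qed.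

Lemma sends_orbit i l b : sends (iterate phi l) (q i) b <-> same_point (q (i + l)%N) b.
Proof.
split=> [[t [ut st]]|sb].
  apply: same_point_trans st; apply: same_point_sym.
  by have := orbit_chart ut; rewrite size_tuple.
have [t st [ut sp]] := orbit_chart_exists i l.
have st' : size t == l by rewrite st.
by exists (Tuple st'); split=> //; apply: same_point_trans sp sb.
Qed.

Lemma reduced_chart i t :
    unimodular (chart_eval (chart_comp (charts_base_change rho phi) t) (rho \o q i)) <->
  unimodular (chart_eval (chart_comp phi t) (q i)).
Proof.
rewrite chart_comp_map -unimodular_residue.
by split=> -[c uc]; exists c; move: uc; rewrite chart_eval_map.
Qed.

Lemma sends_reduced_orbit i l b :
  sends (iterate (charts_base_change rho phi) l) (rho \o q i) b <->
  same_point (rho \o q (i + l)%N) b.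
Proof.
split=> [[t [ut st]]|sb].
  apply: same_point_trans st; apply: same_point_sym.
  move: (ut); rewrite /iterate => /reduced_chart/orbit_chart/(same_point_map rho).
  rewrite size_tuple; apply: same_point_trans; rewrite chart_comp_map.
  exact/same_point_ext/chart_eval_map.
have [t st [ut sp]] := orbit_chart_exists i l.
have st' : size t == l by rewrite st.
exists (Tuple st'); split; first exact/reduced_chart.
apply: same_point_trans sb; apply: same_point_trans (same_point_map rho sp).
rewrite /iterate chart_comp_map; exact/same_point_ext/chart_eval_map.
Qed.

(** A composite chart defined at [q i] is also defined at [q j], and it maps proportional vectors to
    proportional vectors. *)
Lemma orbit_shift i j l : same_point (q i) (q j) -> same_point (q (i + l)%N) (q (j + l)%N).
Proof.
move=> sp; have [t st [ut sp1]] := orbit_chart_exists i l.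
have sp2 := same_point_chart (comp_homog t) sp.
have ut2 := same_point_unimodular sp2 ut.
have := orbit_chart ut2; rewrite st; apply: same_point_trans.
by apply: same_point_trans sp2; apply: same_point_sym.
Qed.

Lemma reduced_orbit_shift i j l : same_point (rho \o q i) (rho \o q j) ->
  same_point (rho \o q (i + l)%N) (rho \o q (j + l)%N).
Proof.
move=> sp; have [t st [ut _]] := orbit_chart_exists i l.
have ut1 := (reduced_chart i t).2 ut.
have hm : homog_tuple (chart_comp (charts_base_change rho phi) t).
  rewrite chart_comp_map; have [e He] := comp_homog t.
  by exists e => c; rewrite tnth_map; apply: map_mpoly_homog.
have sp2 := same_point_chart hm sp.
have ut2 := (reduced_chart j t).1 (same_point_unimodular sp2 ut1).
have f i' : unimodular (chart_eval (chart_comp phi t) (q i')) ->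
  same_point (chart_eval (chart_comp (charts_base_change rho phi) t) (rho \o q i'))
    (rho \o q (i' + l)%N).
  move/orbit_chart/(same_point_map rho); rewrite st; apply: same_point_trans.
  rewrite chart_comp_map; exact/same_point_ext/chart_eval_map.
apply: same_point_trans (same_point_sym (f i ut)) _.
exact: same_point_trans sp2 (f j ut2).
Qed.

Lemma orbit_mod n : primitive_period phi P n ->
  forall i j, same_point (q i) (q j) <-> i = j %[mod n].
Proof.
rewrite -q0 => -[n0 /sends_orbit sn smin]; apply: period_mod => //.
- by move=> i; apply: same_point_refl.
- by move=> i j; apply: same_point_sym.
- by move=> i j l; apply: same_point_trans.
- exact: orbit_shift.
- exact: same_point_sym.
- by move=> s /smin ns sp; apply/ns/sends_orbit/same_point_sym.
Qed.

Lemma reduced_orbit_mod m : primitive_period (charts_base_change rho phi) (rho \o P) m ->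
  forall i j, same_point (rho \o q i) (rho \o q j) <-> i = j %[mod m].
Proof.
rewrite -q0 => -[n0 /sends_reduced_orbit sn smin]; apply: period_mod => //.
- by move=> i; apply: same_point_refl.
- by move=> i j; apply: same_point_sym.
- by move=> i j l; apply: same_point_trans.
- exact: reduced_orbit_shift.
- exact: same_point_sym.
- by move=> s /smin ns sp; apply/ns/sends_reduced_orbit/same_point_sym.
Qed.

(** [orbit_ideal] quantifies over all vectors that represent an orbit point. Their values on a form
    differ by units, so the chosen vectors [q i] suffice. *)
Lemma orbit_idealE n f :
  orbit_ideal phi P n f <-> forall i, (i < n)%N -> ray (q i) f = 0.
Proof.
rewrite -q0; split=> [H i lt|H i b lt].
  apply/ray_eq0; apply: (H i) => //; apply/sends_orbit.
  by rewrite add0n; apply: same_point_refl.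
move/sends_orbit; rewrite add0n => sp e; have /ray_eq0 Hi := H i lt.
by have [u _ ->] := meval_same_point sp (pihomogP mdeg e f); rewrite Hi mulr0.
Qed.

End Orbit.

(** * Cotangent spaces *)

Section Cotangent.
Variables (F : fieldType) (N : nat) (I : {mpoly F[N.+1]} -> Prop).
Hypothesis hI : ideal I.
Variables (a : 'I_N.+1 -> F) (W : vectType F) (dW : germ F N -> W).
Hypothesis hW : cotangent_space I a dW.

Lemma max_ideal_add s t : max_ideal a s -> max_ideal a t -> max_ideal a (germ_add s t).
Proof.
move=> [[s0 [e [s1 s2]]] sa] [[t0 [e' [t1 t2]]] ta]; split; last first.
  by rewrite /= mevalD !mevalM sa ta !mul0r addr0.
split; first by rewrite /= mevalM mulf_neq0.
exists (e + e')%N; split; last exact: dhomogM.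
by rewrite /=; apply: rpredD; [exact: dhomogM|rewrite addnC; exact: dhomogM].
Qed.

Lemma max_ideal_scale c s : max_ideal a s -> max_ideal a (germ_scale c s).
Proof.
move=> [[s0 [e [s1 s2]]] sa]; split; last by rewrite /= mevalZ sa mulr0.
by split=> //; exists e; split=> //; apply: rpredZ.
Qed.

Lemma max_ideal_mul t s : germ_at a t -> max_ideal a s -> max_ideal a (germ_mul t s).
Proof.
move=> [t0 [e [t1 t2]]] [[s0 [e' [s1 s2]]] sa]; split; last first.
  by rewrite /= mevalM sa mulr0.
split; first by rewrite /= mevalM mulf_neq0.
by exists (e + e')%N; split; apply: dhomogM.
Qed.

Lemma I0 : I 0. Proof. by have [] := hI. Qed.

Lemma cotangent_sub s t : max_ideal a s -> max_ideal a t ->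
  dW (germ_add s (germ_scale (-1) t)) = dW s - dW t.
Proof.
move=> ms mt; have [Wa Ws _ _] := hW.
by rewrite Wa //; [rewrite Ws // scaleN1r|exact: max_ideal_scale].
Qed.

Lemma cotangent_eq0 s h e : max_ideal a s -> h \is e.-homog -> h.@[a] != 0 ->
  I (h * s.1) -> dW s = 0.
Proof.
move=> ms Hh ha Ih; have [_ _ Wk _] := hW; apply/Wk => //.
by exists [::]; split=> //; exists h, e; split; rewrite //= mulr1 mul0r subr0.
Qed.

Lemma cotangent_eq s t : max_ideal a s -> max_ideal a t -> germ_eq I a s t ->
  dW s = dW t.
Proof.
move=> ms mt [h [e [Hh ha Ih]]]; apply/eqP; rewrite -subr_eq0 -cotangent_sub //.
apply/eqP; apply: (cotangent_eq0 (h := h) (e := e)) => //.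
  by apply: max_ideal_add => //; apply: max_ideal_scale.
by rewrite /= scaleN1r mulNr.
Qed.

Lemma cotangent_eq_frac s t : max_ideal a s -> max_ideal a t ->
  s.1 * t.2 = t.1 * s.2 -> dW s = dW t.
Proof.
move=> ms mt E; apply: cotangent_eq => //; exists 1, 0%N; split.
- exact: dhomog1.
- by rewrite meval1 oner_neq0.
- by rewrite E subrr mulr0; apply: I0.
Qed.

(** The germ [t * s - t(a) * s] is the product of [t - t(a)] and [s], two elements of the maximal
    ideal. *)
Lemma cotangent_mul t s : germ_at a t -> max_ideal a s ->
  dW (germ_mul t s) = (t.1.@[a] / t.2.@[a]) *: dW s.
Proof.
move=> gt ms; have [Wa Ws Wk _] := hW; set c := _ / _.
have mts := max_ideal_mul gt ms; have mcs := max_ideal_scale c ms.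
apply/eqP; rewrite -subr_eq0 -Ws // -cotangent_sub //; apply/eqP/Wk.
  by apply: max_ideal_add => //; apply: max_ideal_scale.
have [t0 [e [t1 t2]]] := gt.
exists [:: ((t.1 - c *: t.2, t.2), s)]; split.
  move=> st; rewrite inE => /eqP -> /=; split=> //; split; last first.
    by rewrite /= mevalB mevalZ divfK // subrr.
  by split=> //; exists e; split=> //; apply: rpredB => //; apply: rpredZ.
exists 1, 0%N; split; [exact: dhomog1|by rewrite meval1 oner_neq0|].
rewrite /= (_ : 1 * _ = 0); first exact: I0.
by rewrite -!mul_mpolyC mpolyCN mpolyC1; ring.
Qed.

Variable c : 'I_N.+1.
Hypothesis ac : a c != 0.

(* f / x_c^e minus its value at a, times (a c)^e. *)
Definition chart_germ e (f : {mpoly F[N.+1]}) : germ F N :=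
  (a c ^+ e *: f - f.@[a] *: 'X_c ^+ e, 'X_c ^+ e).

Lemma Xc_homog e : ('X_c ^+ e : {mpoly F[N.+1]}) \is e.-homog.
Proof. by rewrite -{2}[e]mul1n; apply: dhomogMn; rewrite dhomogX /= mdeg1. Qed.

Lemma Xc_eval e : ('X_c ^+ e : {mpoly F[N.+1]}).@[a] = a c ^+ e.
Proof. by rewrite rmorphXn /= mevalXU. Qed.

Lemma max_ideal_chart e f : f \is e.-homog -> max_ideal a (chart_germ e f).
Proof.
move=> Hf; split; last first.
  by rewrite /= mevalB !mevalZ Xc_eval mulrC subrr.
split; first by rewrite /= Xc_eval expf_neq0.
exists e; split; last exact: Xc_homog.
by apply: rpredB; apply: rpredZ => //; exact: Xc_homog.
Qed.

Definition coord_diff j := dW (chart_germ 1 'X_j).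
(** The total differential of the form [f], in terms of the differentials [coord_diff j] of the
    coordinates divided by ['X_c]. *)
Definition grad_diff f := \sum_j (f^`M(j)).@[a] *: coord_diff j.

Lemma chart_germD e f g : f \is e.-homog -> g \is e.-homog ->
  dW (chart_germ e (f + g)) = dW (chart_germ e f) + dW (chart_germ e g).
Proof.
move=> Hf Hg; have [Wa _ _ _] := hW; rewrite -Wa; try exact: max_ideal_chart.
apply: cotangent_eq_frac.
- by apply: max_ideal_chart; apply: rpredD.
- by apply: max_ideal_add; apply: max_ideal_chart.
by rewrite /= mevalD -!mul_mpolyC mpolyCD; ring.
Qed.

Lemma chart_germZ e b f : f \is e.-homog ->
  dW (chart_germ e (b *: f)) = b *: dW (chart_germ e f).
Proof.
move=> Hf; have [_ Ws _ _] := hW; rewrite -Ws; last exact: max_ideal_chart.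
apply: cotangent_eq_frac.
- by apply: max_ideal_chart; apply: rpredZ.
- by apply: max_ideal_scale; apply: max_ideal_chart.
by rewrite /= mevalZ -!mul_mpolyC mpolyCM; ring.
Qed.

(** The Leibniz rule. The powers of [a c] in [chart_germ] are what keeps it free of denominators. *)
Lemma chart_germM e e' f g : f \is e.-homog -> g \is e'.-homog ->
  dW (chart_germ (e + e') (f * g)) =
  g.@[a] *: dW (chart_germ e f) + f.@[a] *: dW (chart_germ e' g).
Proof.
move=> Hf Hg; have [Wa Ws _ _] := hW.
pose t : germ F N := (a c ^+ e' *: g, 'X_c ^+ e').
have gt : germ_at a t.
  split; first by rewrite /= Xc_eval expf_neq0.
  by exists e'; split; [apply: rpredZ|apply: Xc_homog].
have Et : g.@[a] = t.1.@[a] / t.2.@[a].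
  by rewrite /= mevalZ Xc_eval mulrC mulKf // expf_neq0.
have mf := max_ideal_chart Hf; have mg := max_ideal_chart Hg.
rewrite {1}Et -cotangent_mul // -Ws // -Wa.
- apply: cotangent_eq_frac.
  + by apply: max_ideal_chart; apply: dhomogM.
  + by apply: max_ideal_add; [apply: max_ideal_mul|apply: max_ideal_scale].
  by rewrite /= mevalM -!mul_mpolyC !mpolyCM !exprD mpolyCM; ring.
- exact: max_ideal_mul.
- exact: max_ideal_scale.
Qed.

(** By linearity it is enough to treat monomials; these follow by induction on the degree, splitting
    off one variable with the Leibniz rule. *)
Lemma cotangent_chart e f : f \is e.-homog -> dW (chart_germ e f) = grad_diff f.
Proof.
have mono (m : 'X_{1..N.+1}) : dW (chart_germ (mdeg m) 'X_[m]) = grad_diff 'X_[m].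
  have [d] := ubnP (mdeg m); elim: d m => // d IH m; rewrite ltnS => lt.
  have [m0|/existsP[i mi]] := altP (@forallP _ (fun i => m i == 0%N)).
    have -> : m = 0%MM by apply/mnmP => i; rewrite mnm0E; apply/eqP/m0.
    rewrite mpolyX0 /grad_diff big1; last first.
      by move=> j _; rewrite -mpolyC1 mderivC meval0 scale0r.
    apply: (cotangent_eq0 (h := 1) (e := 0%N)).
    - apply: max_ideal_chart; rewrite mdeg0; exact: dhomog1.
    - exact: dhomog1.
    - by rewrite meval1 oner_neq0.
    - by rewrite /= mdeg0 !expr0 meval1 subrr mulr0; apply: I0.
  have le : (U_(i) <= m)%MM by rewrite lep1mP.
  have Em : (m - U_(i) + U_(i))%MM = m by apply: submK.
  have Ed : mdeg m = (mdeg (m - U_(i)) + 1)%N by rewrite -{1}Em mdegD mdeg1.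
  rewrite -Em mpolyXD mdegD mdeg1 chart_germM; last first.
  - by rewrite dhomogX /= mdeg1.
  - by rewrite dhomogX.
  rewrite IH; last by rewrite Ed addn1 in lt.
  rewrite mevalXU /grad_diff scaler_sumr.
  have -> : dW (chart_germ 1 'X_i) = \sum_j (i == j)%:R *: coord_diff j.
    rewrite (bigD1 i) //= eqxx scale1r big1 ?addr0 // => j.
    by rewrite eq_sym => /negbTE ->; rewrite scale0r.
  rewrite scaler_sumr -big_split /=; apply: eq_bigr => j _.
  rewrite !scalerA -scalerDl; congr (_ *: _).
  rewrite mderivM mevalD !mevalM mevalXU mulrC; congr (_ + _ * _).
  rewrite mderivX mevalZ mnm1E; case: eqP => [->|]; rewrite ?mul0r //.
  rewrite (_ : (U_(j) - U_(j))%MM = 0%MM) ?mpolyX0 ?meval1 ?mulr1 //.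
  by apply/mnmP => l; rewrite mnmBE subnn mnm0E.
move/dhomogP => Hf.
rewrite [f]mpolyE.
have -> : grad_diff (\sum_(m <- msupp f) f@_m *: 'X_[m]) =
  \sum_(m <- msupp f) f@_m *: grad_diff 'X_[m].
  rewrite /grad_diff; under [RHS]eq_bigr do rewrite scaler_sumr.
  rewrite exchange_big /=; apply: eq_bigr => j _.
  rewrite (raddf_sum (mderiv j)) (raddf_sum (meval a)) /= scaler_suml.
  by apply: eq_bigr => m _; rewrite linearZ /= mevalZ scalerA.
have : {in msupp f, forall m, mdeg m = e} by [].
elim: (msupp f) => [_|m r IH Hr].
  rewrite !big_nil; apply: (cotangent_eq0 (h := 1) (e := 0%N)).
  - apply: max_ideal_chart; exact: dhomog0.
  - exact: dhomog1.
  - by rewrite meval1 oner_neq0.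
  - by rewrite /= meval0 scale0r subr0 scaler0 mulr0; apply: I0.
have em := Hr m (mem_head _ _).
have Hr' : {in r, forall m, mdeg m = e} by move=> x xr; apply: Hr; rewrite inE xr orbT.
rewrite !big_cons chart_germD; last first.
- rewrite big_seq; apply: rpred_sum => x /Hr' ex; apply: rpredZ.
  by rewrite dhomogX; apply/eqP.
- by apply: rpredZ; rewrite dhomogX; apply/eqP.
rewrite IH // chart_germZ; last by rewrite dhomogX; apply/eqP.
by rewrite -em mono.
Qed.

Lemma cotangent_grad s : max_ideal a s -> dW s = (s.2.@[a])^-1 *: grad_diff s.1.
Proof.
move=> ms; have [[s0 [e [s1 s2]]] sa] := ms.
rewrite -(cotangent_chart s1).
(* Multiplication by this invertible germ replaces the denominator ['X_c ^+ e] of the chart germ by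
   that of [s]; its value at [a] is the inverse of [s.2.@[a]]. *)
pose t : germ F N := ('X_c ^+ e, a c ^+ e *: s.2).
have ce : a c ^+ e != 0 by rewrite expf_neq0.
have gt : germ_at a t.
  split; first by rewrite /= mevalZ mulf_neq0.
  by exists e; split; [exact: Xc_homog|exact: rpredZ].
have -> : (s.2.@[a])^-1 = t.1.@[a] / t.2.@[a].
  by rewrite /= mevalZ Xc_eval invfM mulVKf.
have mc := max_ideal_chart s1.
rewrite -cotangent_mul //; apply: cotangent_eq_frac => //; first exact: max_ideal_mul.
by rewrite /= sa scale0r subr0 -!mul_mpolyC; ring.
Qed.

Lemma grad_relation e g : g \is e.-homog -> g.@[a] = 0 -> I g -> grad_diff g = 0.
Proof.
move=> Hg ga Ig; rewrite -(cotangent_chart Hg).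
apply: (cotangent_eq0 (h := 1) (e := 0%N)); first exact: max_ideal_chart.
- exact: dhomog1.
- by rewrite meval1 oner_neq0.
have [_ _ Im] := hI.
by rewrite /= ga scale0r subr0 -mul_mpolyC mul1r; apply: Im.
Qed.

Lemma coord_diff_chart : coord_diff c = 0.
Proof.
apply: (cotangent_eq0 (h := 1) (e := 0%N)).
- by apply: max_ideal_chart; rewrite dhomogX /= mdeg1.
- exact: dhomog1.
- by rewrite meval1 oner_neq0.
- by rewrite /= mevalXU !expr1 subrr mulr0; apply: I0.
Qed.

Definition jacobian s (g : 'I_s -> {mpoly F[N.+1]}) : 'M_(s, N.+1) :=
  \matrix_(i, j) ((g i)^`M(j)).@[a].

(** The [N.+1] coordinate differentials span [W] and satisfy [s.+1] independent linear relations: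
    the [s] gradients, and the vanishing of the differential of index [c]. *)
Lemma cotangent_dim s (g : 'I_s -> {mpoly F[N.+1]}) (col : 'I_s -> 'I_N.+1) :
    (forall i, I (g i) /\ exists e, g i \is e.-homog) -> (forall i, (g i).@[a] = 0) ->
    (forall i, col i != c) -> colsub col (jacobian g) \in unitmx ->
  (\dim (fullv : {vspace W}) + s <= N)%N.
Proof.
move=> hg ga hcol uJ.
pose b := vbasis (fullv : {vspace W}).
pose D : 'M_(N.+1, \dim (fullv : {vspace W})) := \matrix_(j, i) coord b i (coord_diff j).
have combD (y : 'rV_N.+1) i : (y *m D) 0 i = coord b i (\sum_j y 0 j *: coord_diff j).
  by rewrite mxE linear_sum; apply: eq_bigr => j _; rewrite linearZ mxE.
have fD : row_full D.
  rewrite -sub1mx; apply/row_subP => i; rewrite row1.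
  have [_ _ _ Wsurj] := hW; have [s' ms Es] := Wsurj b`_i.
  rewrite (_ : delta_mx 0 i = ((s'.2.@[a])^-1 *: \row_j ((s'.1)^`M(j)).@[a]) *m D).
    exact: submxMl.
  apply/rowP => i'; rewrite combD (_ : \sum_j _ = b`_i); last first.
    rewrite -Es cotangent_grad // /grad_diff scaler_sumr; apply: eq_bigr => j _.
    by rewrite !mxE scalerA.
  by rewrite coord_free ?(basis_free (vbasisP _)) // mxE eqxx eq_sym.
pose E := col_mx (jacobian g) (delta_mx 0 c : 'rV_N.+1).
have ED : E *m D = 0.
  rewrite mul_col_mx; apply/matrixP => l i; rewrite [RHS]mxE.
  rewrite -[l]splitK; case: (split l) => {}l /=; rewrite ?col_mxEu ?col_mxEd.
    have -> : (jacobian g *m D) l i = (row l (jacobian g) *m D) 0 i.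
      by rewrite -row_mul [RHS]mxE.
    have [Ig [e He]] := hg l; rewrite combD (_ : \sum_j _ = grad_diff (g l)).
      by rewrite (grad_relation He) ?linear0.
    by apply: eq_bigr => j _; rewrite !mxE.
  rewrite [l]ord1 combD (_ : \sum_j _ = 0) ?linear0 //.
  rewrite big1 // => j _; rewrite mxE /=; case: eqP => [->|]; rewrite ?scale0r //.
  by rewrite coord_diff_chart scaler0.
(* The columns [col] avoid [c], so they see only the Jacobian rows and kill their coefficients;
   column [c] then kills the remaining one. *)
have fE : row_free E.
  apply: inj_row_free => x; rewrite -[x]hsubmxK mul_row_col => E0.
  have z0 : lsubmx x = 0.
    have : lsubmx x *m colsub col (jacobian g) = 0.
      apply/rowP => l; have := congr1 (fun y : 'rV_N.+1 => y 0 (col l)) E0.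
      rewrite /= mxE [X in _ + X]mxE big_ord1 [delta_mx _ _ _ _]mxE /=.
      rewrite (negbTE (hcol l)) mulr0 addr0 [RHS]mxE => Hl; rewrite [RHS]mxE -[RHS]Hl.
      rewrite [LHS]mxE [RHS]mxE; apply: eq_bigr => j _; congr (_ * _).
      by rewrite [LHS]mxE.
    by move/(congr1 (mulmx^~ (invmx (colsub col (jacobian g)))));
      rewrite mulmxK // mul0mx.
  rewrite z0 mul0mx add0r in E0.
  have := congr1 (fun y : 'rV_N.+1 => y 0 c) E0.
  rewrite /= mxE big_ord1 [delta_mx _ _ _ _]mxE !eqxx mulr1 [RHS]mxE => Hr.
  by rewrite z0; apply/rowP => l; rewrite -[l]splitK; case: (split l) => {}l /=;
    rewrite ?row_mxEl ?row_mxEr !mxE // [l]ord1 -[RHS]Hr mxE.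
have := mulmx0_rank_max ED; rewrite (eqP fD) (eqP fE); lia.
Qed.

End Cotangent.

(** * Linear maps and their matrices *)

Lemma linfun_exists (F : fieldType) (U V : vectType F) (f : U -> V) :
  linear f -> exists g : 'Hom(U, V), g =1 f.
Proof.
move=> lf; pose fl : {linear U -> V} := HB.pack f (GRing.isLinear.Build F U V *:%R f lf).
by exists (linfun fl) => x; rewrite lfunE.
Qed.

Section HomMatrix.
Import VectorInternalTheory.
Variable F : fieldType.

Definition hom_mx (U V : vectType F) (f : 'Hom(U, V)) := lin1_mx (v2r \o f \o r2v).

Lemma hom_mxE (U V : vectType F) (f : 'Hom(U, V)) u : v2r (f u) = v2r u *m hom_mx f.
Proof. by rewrite mul_rV_lin1 /= v2rK. Qed.

Lemma iter_hom_mx (U : vectType F) (f : 'End(U)) i u :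
  v2r (iter i f u) = v2r u *m hom_mx f ^+ i.
Proof.
elim: i => [|i IH]; first by rewrite expr0 mulmx1.
by rewrite iterS hom_mxE IH exprSr mulmxA.
Qed.

(** The matrix statement [quotient_embeds], transported to abstract spaces through coordinates. *)
Lemma hom_quotient_embeds (W T : vectType F) (q : 'Hom(W, T)) (L : 'End(W)) (M : 'End(T)) :
    (forall x, exists w, q w = x) -> (forall w, q (L w) = M (q w)) ->
  exists2 g : 'Hom(T, W), lker g = 0%VS & forall x, g (M x) = L (g x).
Proof.
move=> qs qL.
have fQ : row_full (hom_mx q).
  rewrite -sub1mx; apply/row_subP => i; rewrite row1.
  have [w Ew] := qs (r2v (delta_mx 0 i)).
  have <- : v2r (q w) = delta_mx 0 i by rewrite Ew r2vK.
  by rewrite hom_mxE submxMl.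
have LQ : hom_mx L *m hom_mx q = hom_mx q *m hom_mx M.
  apply/row_matrixP => i; rewrite !rowE !mulmxA.
  by rewrite -[delta_mx _ _]r2vK -!hom_mxE qL.
have [E fE EM] := quotient_embeds fQ LQ.
have lg : linear (fun x : T => r2v (v2r x *m E) : W).
  by move=> c x y /=; rewrite linearP mulmxDl -scalemxAl linearP.
have [g Eg] := linfun_exists lg; exists g.
  apply/eqP; rewrite -subv0; apply/subvP => x; rewrite memv_ker memv0 Eg => /eqP E0.
  have : v2r x *m E = 0 by rewrite -[LHS]r2vK E0 linear0.
  move/eqP; rewrite mulmx_free_eq0 // => /eqP x0.
  by rewrite -[x]v2rK x0 linear0.
move=> x; apply: (can_inj v2rK).
by rewrite Eg r2vK hom_mxE [RHS]hom_mxE Eg r2vK -!mulmxA EM.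
Qed.

End HomMatrix.

Lemma hom_order_bound (k : finFieldType) (T : vectType k) (M : 'End(T)) r :
    (0 < \dim (fullv : {vspace T}))%N -> order_on M fullv r ->
  (r <= #|k| ^ \dim (fullv : {vspace T}) - 1)%N.
Proof.
rewrite dimvf => d0 [r0 Mr Hr].
have mx1 i : hom_mx M ^+ i = 1%:M <-> forall w, iter i M w = w.
  split=> [E w|H]; first apply: (can_inj VectorInternalTheory.v2rK).
    by rewrite iter_hom_mx E mulmx1.
  apply/row_matrixP => j; rewrite !rowE mulmx1 -[delta_mx _ _]VectorInternalTheory.r2vK.
  by rewrite -iter_hom_mx H.
apply: (order_bound (A := hom_mx M)) => //.
  have : hom_mx M ^+ r = 1%:M by apply/mx1 => w; apply: Mr; apply: memvf.
  case: r r0 {Mr Hr} => // r _; rewrite exprS => E.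
  by have [] := mulmx1_unit E.
by move=> s /Hr ns; apply/eqP => /mx1 H; apply: ns => w _; apply: H.
Qed.

(** The least positive period divides every other one, because the remainder of a division by it is
    again a period. *)
Lemma order_exists (k : fieldType) (T : vectType k) (M : 'End(T)) l :
    (0 < l)%N -> (forall x, iter l M x = x) ->
  exists r, order_on M fullv r /\ (r %| l)%N.
Proof.
move=> l0 Hl.
pose P s := (0 < s)%N /\ forall x, iter s M x = x.
have [r [[r0 Mr] rmin]] : exists r, P r /\ forall s, P s -> (r <= s)%N.
  have : P l by [].
  elim/ltn_ind: l {l0 Hl} => l IH Pl.
  have [[s [sl Ps]]|H] := classic (exists s, (s < l)%N /\ P s); first exact: IH sl Ps.
  exists l; split=> // s Ps; rewrite leqNgt; apply/negP => sl; apply: H; by exists s.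
have Mmul c x : iter (c * r) M x = x.
  by elim: c x => [//|c IH] x; rewrite mulSn iterD IH Mr.
exists r; split.
  split=> //; move=> s /andP[s0 sr] H.
  have := rmin s (conj s0 (fun x => H x (memvf x))); by rewrite leqNgt sr.
rewrite /dvdn; apply/eqP.
have [//|p0] := posnP (l %% r).
have : P (l %% r)%N.
  by split=> // x; have := Hl x; rewrite {1}(divn_eq l r) addnC iterD Mmul.
by move/rmin; rewrite leqNgt ltn_mod r0.
Qed.

(** * Functoriality of cotangent spaces and base change of ideals *)

(** Fractions of the maximal ideal do not depend on the subscheme. Enlarging the ideal only adds
    relations, so sending [dW s] to [dT s] is well defined. *)
Lemma cotangent_quotient (F : fieldType) N (I I' : {mpoly F[N.+1]} -> Prop)
    (a : 'I_N.+1 -> F) (W T : vectType F) (dW : germ F N -> W) (dT : germ F N -> T) :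
    (forall f, I f -> I' f) -> cotangent_space I a dW -> cotangent_space I' a dT ->
  exists q : 'Hom(W, T), forall s, max_ideal a s -> q (dW s) = dT s.
Proof.
move=> sub hW hT; have [Wa Ws Wk Wsurj] := hW; have [Ta Ts Tk _] := hT.
have lift w : {s | max_ideal a s /\ dW s = w}.
  by apply: constructive_indefinite_description; have [s] := Wsurj w; exists s.
have wd s t : max_ideal a s -> max_ideal a t -> dW s = dW t -> dT s = dT t.
  move=> ms mt E; apply/eqP; rewrite -subr_eq0 -(cotangent_sub hT) //; apply/eqP/Tk.
    by apply: max_ideal_add => //; apply: max_ideal_scale.
  have : dW (germ_add s (germ_scale (-1) t)) = 0 by rewrite (cotangent_sub hW) // E subrr.
  move/Wk => []; first by apply: max_ideal_add => //; apply: max_ideal_scale.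
  move=> l [Hl [h [e [Hh ha Ih]]]]; exists l; split=> //.
  by exists h, e; split=> //; apply: sub.
have lf : linear (fun w => dT (sval (lift w))).
  move=> c w w'; case: (lift _) => s [ms Es]; case: (lift w) => t [mt Et].
  case: (lift w') => t' [mt' Et'] /=.
  have mc := max_ideal_scale c mt.
  rewrite -Ts // -Ta //; apply: wd => //; first exact: max_ideal_add.
  by rewrite Es Wa // Ws // Et Et'.
have [q Eq] := linfun_exists lf; exists q => s ms; rewrite Eq.
by case: (lift _) => t [mt Et] /=; apply: wd.
Qed.

Lemma base_change_ideal (A B : comNzRingType) (f : {rmorphism A -> B}) N
  (I : {mpoly A[N.+1]} -> Prop) : ideal (base_change f I).
Proof.
split.
- exists 0%N, (fun _ => 0), (fun _ => 0); rewrite big_ord0; by split=> // -[].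
- move=> _ _ [l [q [g [Hg ->]]]] [l' [q' [g' [Hg' ->]]]].
  exists (l + l')%N, (fun i => match split i with inl j => q j | inr j => q' j end),
    (fun i => match split i with inl j => g j | inr j => g' j end).
  split=> [i|]; first by case: (split i).
  rewrite big_split_ord /=; congr (_ + _); apply: eq_bigr => i _.
    by rewrite (unsplitK (inl i)).
  by rewrite (unsplitK (inr i)).
- move=> h _ [l [q [g [Hg ->]]]]; exists l, (fun i => h * q i), g; split=> //.
  by rewrite mulr_sumr; apply: eq_bigr => i _; rewrite mulrA.
Qed.

Lemma base_change_map (A B : comNzRingType) (f : {rmorphism A -> B}) N
  (I : {mpoly A[N.+1]} -> Prop) g : I g -> base_change f I (map_mpoly f g).
Proof.
by move=> Ig; exists 1%N, (fun _ => 1), (fun _ => g); rewrite big_ord1 mul1r.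
Qed.

(** * Functions on the orbit *)

(** If no form [y j *: 'X_i - y i *: 'X_j] has a unit value at [x], all minors of the two reduced
    vectors vanish and the reductions coincide. *)
Lemma separating_form (R : idomainType) (k : fieldType) (rho : {rmorphism R -> k})
    N (x y : 'I_N.+1 -> R) : residue_map rho -> unimodular x -> unimodular y ->
    ~ same_point (rho \o x) (rho \o y) ->
  exists2 f, f \is 1.-homog & f.@[y] = 0 /\ f.@[x] \is a GRing.unit.
Proof.
move=> hk [c uc] uy ns.
have [//|H] := classic (exists2 f, f \is 1.-homog & f.@[y] = 0 /\ f.@[x] \is a GRing.unit).
case: ns.
have xc : rho (x c) != 0 by rewrite -(unit_residue hk).
have E i j : rho (x i) * rho (y j) = rho (x j) * rho (y i).
  apply/eqP; rewrite -subr_eq0 -!rmorphM -rmorphB -[_ == 0]negbK -(unit_residue hk).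
  apply/negP => u; apply: H; exists (y j *: 'X_i - y i *: 'X_j).
    by apply: rpredB; apply: rpredZ; rewrite dhomogX /= mdeg1.
  rewrite !mevalB !mevalZ !mevalXU; split; first by ring.
  by move: u; congr (_ \is a _); ring.
have Ey i : rho (y i) = rho (y c) / rho (x c) * rho (x i).
  by apply: (mulfI xc); rewrite E mulrA (mulrC (rho (x c))) divfK // mulrC.
exists (rho (y c) / rho (x c)); last exact: Ey.
rewrite unitfE; have [i] := uy; rewrite (unit_residue hk) Ey => yi.
by apply: contraNneq yi => ->; rewrite mul0r.
Qed.

Lemma map_mpoly_eq0_dvd (R : idomainType) (k : fieldType) (rho : {rmorphism R -> k})
    (pi : R) n (f : {mpoly R[n]}) : residue_map rho -> uniformizer pi ->
  map_mpoly rho f = 0 -> exists g, f = pi *: g.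
Proof.
move=> [_ hk] [_ hpi _] f0.
have Hm m : {y | f@_m = pi * y}.
  apply: constructive_indefinite_description; apply: hpi.
  by apply/hk; rewrite -mcoeff_map_mpoly f0 mcoeff0.
exists (\sum_(m <- msupp f) sval (Hm m) *: 'X_[m]).
rewrite {1}[f]mpolyE scaler_sumr; apply: eq_bigr => m _.
by rewrite scalerA -(svalP (Hm m)).
Qed.

Section Sequences.
Variables (R : idomainType) (k : fieldType) (rho : {rmorphism R -> k}).
Hypothesis hk : residue_map rho.
Variables (pi : R).
Hypothesis hpi : uniformizer pi.
Variables (N : nat) (X : {mpoly R[N.+1]} -> Prop).
Variables (J : Type) (phi : charts J R N).
Hypothesis hphi : endomorphism X phi.
Variables (q : nat -> 'I_N.+1 -> R).
Hypothesis qX : forall s, rational_point X (q s).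
Hypothesis qS : forall s, exists2 j,
  unimodular (chart_eval (phi j) (q s)) & q s.+1 = chart_eval (phi j) (q s).
Variables (n m : nat).
Hypothesis hn : primitive_period phi (q 0%N) n.
Hypothesis hm : primitive_period (charts_base_change rho phi) (rho \o q 0%N) m.
Variables (T : vectType k) (dT : germ k N -> T).
Hypothesis hT :
  cotangent_space (base_change rho (orbit_ideal phi (q 0%N) n)) (rho \o q 0%N) dT.
Variable M : 'End(T).
Hypothesis hM :
  induced_map (rho \o q 0%N) (iterate (charts_base_change rho phi) m) dT M.

Local Notation P := (q 0%N).
Local Notation a := (rho \o q 0%N).
Local Notation Q i := (q (m * i)%N).
Local Notation I := (base_change rho (orbit_ideal phi P n)).

Let omod := orbit_mod hk hphi (erefl P) qX qS hn.
Let rmod := reduced_orbit_mod hk hphi (erefl P) qX qS hm.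

Lemma rho_eq0 x : rho x = 0 -> dvd_pow pi 1 x.
Proof.
have [_ H] := hk; have [_ H' _] := hpi.
by move/H/H' => [y ->]; exists y; rewrite expr1.
Qed.

Lemma reduced_orbit i : same_point (rho \o P) (rho \o Q i).
Proof. by apply/rmod; rewrite mod0n modnMr. Qed.

Lemma rho_orbit e f i : f \is e.-homog ->
  exists2 u, u != 0 & rho f.@[Q i] = u * rho f.@[P].
Proof.
move=> Hf; have [u uu Eu] := meval_same_point (reduced_orbit i) (map_mpoly_homog rho Hf).
by exists u; [rewrite -unitfE|rewrite -!map_mpoly_eval].
Qed.

Lemma unit_orbit e f i : f \is e.-homog -> f.@[P] \is a GRing.unit ->
  f.@[Q i] \is a GRing.unit.
Proof.
rewrite !(unit_residue hk) => /(rho_orbit i)[u u0 ->] f0; exact: mulf_neq0.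
Qed.

(** The values of [F1 / F2], written without division. Equal degrees make them independent of the
    vectors chosen for the points. A unit value of [F2] at [P] is enough, since all [Q i] have the
    reduction of [P]. *)
Definition fraction_seq e (F1 F2 : {mpoly R[N.+1]}) (g : nat -> R) :=
  [/\ F1 \is e.-homog, F2 \is e.-homog, F2.@[P] \is a GRing.unit
    & forall i, g i * F2.@[Q i] = F1.@[Q i]].

(* The values along the phi^m-orbit of the functions regular at P. *)
Definition regular_seq g := exists e F1 F2, fraction_seq e F1 F2 g.

(* x is the differential of the reduction of a function with values g. *)
Definition seq_diff g x := exists e F1 F2,
  [/\ fraction_seq e F1 F2 g, rho F1.@[P] = 0 & dT (map_mpoly rho F1, map_mpoly rho F2) = x].

Lemma fraction_max_ideal e F1 F2 g : fraction_seq e F1 F2 g -> rho F1.@[P] = 0 ->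
  max_ideal a (map_mpoly rho F1, map_mpoly rho F2).
Proof.
move=> [H1 H2 u _] z; split; last by rewrite /= map_mpoly_eval.
split; first by rewrite /= map_mpoly_eval -(unit_residue hk).
by exists e; split; apply: map_mpoly_homog.
Qed.

Lemma fraction_val e F1 F2 : F1 \is e.-homog -> F2 \is e.-homog ->
    F2.@[P] \is a GRing.unit ->
  fraction_seq e F1 F2 (fun i => F1.@[Q i] / F2.@[Q i]).
Proof.
by move=> H1 H2 u; split=> // i; rewrite divrK // (unit_orbit i H2).
Qed.

Lemma fraction_dvd e F1 F2 g i : fraction_seq e F1 F2 g -> rho F1.@[P] = 0 ->
  dvd_pow pi 1 (g i).
Proof.
move=> [H1 H2 u Eg] z; apply: rho_eq0.
have [w _] := rho_orbit i H1; rewrite z mulr0 -Eg rmorphM => /eqP.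
by rewrite mulf_eq0 => /orP[/eqP //|]; 
  rewrite -[_ == 0]negbK -(unit_residue hk) (unit_orbit i H2).
Qed.

Lemma lift_max_ideal s : max_ideal a s -> exists e F1 F2 g,
  [/\ fraction_seq e F1 F2 g, rho F1.@[P] = 0, s = (map_mpoly rho F1, map_mpoly rho F2)
    & regular_seq g /\ forall i, dvd_pow pi 1 (g i)].
Proof.
case: s => s1 s2 [[/= s20 [e [H1 H2]]] sa]; have [rs _] := hk.
have [F1 HF1 E1] := map_mpoly_homog_surj rs H1.
have [F2 HF2 E2] := map_mpoly_homog_surj rs H2.
have u : F2.@[P] \is a GRing.unit by rewrite (unit_residue hk) -map_mpoly_eval E2.
have z : rho F1.@[P] = 0 by rewrite -map_mpoly_eval E1.
have H := fraction_val HF1 HF2 u.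
exists e, F1, F2, (fun i => F1.@[Q i] / F2.@[Q i]); split; rewrite ?E1 ?E2 //.
by split; [exists e, F1, F2|move=> i; apply: fraction_dvd H z].
Qed.

Lemma seq_diff_exists x : exists g, seq_diff g x.
Proof.
have [_ _ _ Tsurj] := hT; have [s ms <-] := Tsurj x.
have [e [F1 [F2 [g [H z -> _]]]]] := lift_max_ideal ms.
by exists g, e, F1, F2.
Qed.

Lemma seq_diff_ex g : regular_seq g -> (forall i, dvd_pow pi 1 (g i)) ->
  exists x, seq_diff g x.
Proof.
move=> [e [F1 [F2 H]]] dg; exists (dT (map_mpoly rho F1, map_mpoly rho F2)), e, F1, F2.
split=> //; have [_ _ _ Eg] := H; have := Eg 0%N; rewrite muln0 => <-.
have [y ->] := dg 0%N; have [_ hk0] := hk; have [npi _ _] := hpi.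
by rewrite expr1 !rmorphM (hk0 pi).2 // !mul0r.
Qed.

Lemma seq_diff_sub g x g' x' : seq_diff g x -> seq_diff g' x' ->
  seq_diff (fun i => g i - g' i) (x - x').
Proof.
move=> [e [F1 [F2 [H z <-]]]] [e' [F1' [F2' [H' z' <-]]]].
have ms := fraction_max_ideal H z; have ms' := fraction_max_ideal H' z'.
rewrite -(cotangent_sub hT) //.
have [H1 H2 u Eg] := H; have [H1' H2' u' Eg'] := H'.
exists (e + e')%N, (F1 * F2' - F1' * F2), (F2 * F2'); split.
- split.
  + by apply: rpredB; [exact: dhomogM|rewrite addnC; exact: dhomogM].
  + exact: dhomogM.
  + by rewrite mevalM unitrM u.
  + by move=> i; rewrite mevalB !mevalM -Eg -Eg'; ring.
- by rewrite mevalB !mevalM rmorphB !rmorphM /= z z' !mul0r subrr.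
- by rewrite /germ_add /= rmorphB !rmorphM /= scaleN1r mulNr.
Qed.

(** Replacing [F1] by [F1 - g 0 *: F2] gives a fraction vanishing at [P], hence modulo [pi] at every
    [Q i]. *)
Lemma regular_seq0 g : regular_seq g ->
  regular_seq (fun i => g i - g 0%N) /\ forall i, dvd_pow pi 1 (g i - g 0%N).
Proof.
move=> [e [F1 [F2 [H1 H2 u Eg]]]].
have H : fraction_seq e (F1 - g 0%N *: F2) F2 (fun i => g i - g 0%N).
  split=> //; first by apply: rpredB => //; apply: rpredZ.
  by move=> i; rewrite mevalB mevalZ mulrBl Eg.
split=> [|i]; first by exists e, (F1 - g 0%N *: F2), F2.
apply: fraction_dvd H _; have := Eg 0%N; rewrite muln0 mevalB mevalZ => ->.
by rewrite subrr rmorph0.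
Qed.

(** The quotients of coordinates by one that is a unit at [P] are regular, and they determine the
    point. *)
Lemma regular_seq_separates i j : (forall g, regular_seq g -> g i = g j) ->
  same_point (Q i) (Q j).
Proof.
move=> H; have [[c uc] _] := qX 0%N.
have HX l : ('X_l : {mpoly R[N.+1]}) \is 1.-homog by rewrite dhomogX /= mdeg1.
have uc' : ('X_c).@[P] \is a GRing.unit by rewrite mevalXU.
have ucQ l : Q l c \is a GRing.unit by have := unit_orbit l (HX c) uc'; rewrite mevalXU.
exists (Q j c / Q i c); first by rewrite unitrM unitrV !ucQ.
move=> l.
have : Q i l / Q i c = Q j l / Q j c.
  have HF : regular_seq (fun i => ('X_l).@[Q i] / ('X_c).@[Q i]).
    by exists 1%N, 'X_l, 'X_c; apply: fraction_val.
  by have := H _ HF; rewrite !mevalXU.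
by move=> E; rewrite -mulrA [_^-1 * _]mulrC E mulrC divrK.
Qed.

Lemma orbit_ideal_eval f i e : orbit_ideal phi P n f -> (pihomog mdeg e f).@[q i] = 0.
Proof.
move/(orbit_idealE hk hphi (erefl P) qX qS) => H; have [n0 _ _] := hn.
have /ray_eq0 Hi := H (i %% n)%N (ltn_pmod i n0).
have sp : same_point (q (i %% n)%N) (q i) by apply/omod; rewrite modn_mod.
by have [u _ ->] := meval_same_point sp (pihomogP mdeg e f); rewrite Hi mulr0.
Qed.

(** Each factor of a sum of products in the special fiber is lifted to [R]; the resulting fraction
    [T1 / T2] has a sum of products of sequences divisible by [pi] as values. *)
Lemma lift_square l :
    (forall st, st \in l -> max_ideal a st.1 /\ max_ideal a st.2) ->
  exists e T1 T2 L (b c : 'I_L -> nat -> R),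
    [/\ [/\ T1 \is e.-homog, T2 \is e.-homog & T2.@[P] \is a GRing.unit],
      (map_mpoly rho T1, map_mpoly rho T2) =
        foldr (fun st r => germ_add (germ_mul st.1 st.2) r) (0, 1) l,
      forall j, regular_seq (b j) /\ forall i, dvd_pow pi 1 (b j i),
      forall j, regular_seq (c j) /\ forall i, dvd_pow pi 1 (c j i)
    & forall i, T1.@[Q i] = T2.@[Q i] * \sum_j b j i * c j i].
Proof.
elim: l => [_|[s t] l IH Hl].
  exists 0%N, 0, 1, 0%N, (fun _ _ => 0), (fun _ _ => 0); split; try by case.
  - by rewrite dhomog0 dhomog1 meval1 unitr1.
  - by rewrite rmorph0 rmorph1.
  - by move=> i; rewrite big_ord0 mulr0 meval0.
have [/= ms mt] := Hl _ (mem_head _ _).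
have [|e [T1 [T2 [L [b [c [[H1 H2 u] El Hb Hc ET]]]]]]] := IH.
  by move=> st stl; apply: Hl; rewrite inE stl orbT.
have [d [F1 [F2 [g [[HF1 HF2 uF Eg] _ Es Hg]]]]] := lift_max_ideal ms.
have [d' [G1 [G2 [g' [[HG1 HG2 uG Eg'] _ Et Hg']]]]] := lift_max_ideal mt.
exists (d + d' + e)%N, (F1 * G1 * T2 + T1 * (F2 * G2)), (F2 * G2 * T2), L.+1,
  (fun j => if unlift ord0 j is Some j' then b j' else g),
  (fun j => if unlift ord0 j is Some j' then c j' else g'); split.
- split.
  + apply: rpredD; first by apply: dhomogM => //; apply: dhomogM.
    by rewrite addnC; apply: dhomogM => //; apply: dhomogM.
  + by apply: dhomogM => //; apply: dhomogM.
  + by rewrite !mevalM !unitrM uF uG.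
- by rewrite /= -El Es Et /germ_add /germ_mul /= !(rmorphD, rmorphM).
- by move=> j; case: unliftP.
- by move=> j; case: unliftP.
- move=> i; rewrite big_ord_recl unlift_none.
  under eq_bigr do rewrite liftK.
  by rewrite mevalD !mevalM ET -Eg -Eg'; ring.
Qed.

(** A zero differential means that [F1 / F2] agrees with some [T1 / T2] from the square of the
    maximal ideal, up to the reduced orbit ideal. Lifting, [G * (F1 * T2 - T1 * F2)] is
    [S + pi *: E] with [S] in the orbit ideal. Along the orbit [S] vanishes, which leaves a sum of
    products plus a multiple of [pi]. *)
Lemma seq_diff0 g : seq_diff g 0 -> decomposable pi regular_seq g.
Proof.
move=> [e [F1 [F2 [H z E0]]]]; have ms := fraction_max_ideal H z.
have [_ _ Tk _] := hT; have [rs _] := hk; have [H1 H2 u Eg] := H.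
have [l [Hl [h [eh [Hh ha Ih]]]]] := (Tk _ ms).1 E0.
have [d [T1 [T2 [L [b [c [[HT1 HT2 uT] El Hb Hc ET]]]]]]] := lift_square Hl.
rewrite -El /= in Ih.
have [G HG EG] := map_mpoly_homog_surj rs Hh.
have uG : G.@[P] \is a GRing.unit by rewrite (unit_residue hk) -map_mpoly_eval EG.
have [l' [p [f [Hf Ef]]]] := Ih.
have lp j : {p' | map_mpoly rho p' = p j}.
  exact/constructive_indefinite_description/map_mpoly_surj.
pose S := \sum_j sval (lp j) * f j.
(* The lifted coefficients in [S] and [E] are arbitrary polynomials; only the component of this
   degree, that of the left side, is evaluated. *)
pose D := (eh + (e + d))%N.
have [|E EE] := @map_mpoly_eq0_dvd _ _ rho pi _ (G * (F1 * T2 - T1 * F2) - S) hk hpi.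
  rewrite rmorphB rmorphM rmorphB !rmorphM /= EG Ef rmorph_sum /=.
  apply/eqP; rewrite subr_eq0; apply/eqP/eq_bigr => j _.
  by rewrite rmorphM /= (svalP (lp j)).
have HD : G * (F1 * T2 - T1 * F2) \is D.-homog.
  apply: dhomogM => //; apply: rpredB; first exact: dhomogM.
  by rewrite addnC; apply: dhomogM.
have S0 i : (pihomog mdeg D S).@[Q i] = 0.
  rewrite /S -coef_ray (rmorph_sum (ray (Q i))) /= coef_sum big1 // => j _.
  rewrite (rmorphM (ray (Q i))) /=.
  have -> : ray (Q i) (f j) = 0 by apply/ray_eq0 => e'; apply: orbit_ideal_eval.
  by rewrite mulr0 coef0.
have HE i : G.@[Q i] * (F1.@[Q i] * T2.@[Q i] - T1.@[Q i] * F2.@[Q i]) =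
    pi * (pihomog mdeg D E).@[Q i].
  rewrite -!mevalM -mevalB -mevalM -[in LHS](pihomog_dE HD).
  rewrite -[G * _](subrK S) EE raddfD /= mevalD S0 addr0.
  by rewrite linearZ /= mevalZ.
have HGT : G * (F2 * T2) \is D.-homog by apply: dhomogM => //; apply: dhomogM.
have uGT : (G * (F2 * T2)).@[P] \is a GRing.unit by rewrite !mevalM !unitrM uG u.
exists L, b, c, (fun i => (pihomog mdeg D E).@[Q i] / (G * (F2 * T2)).@[Q i]); split=> //.
  exists D, (pihomog mdeg D E), (G * (F2 * T2)).
  by apply: fraction_val => //; apply: pihomogP.
move=> i; have uQ := unit_orbit i HGT uGT.
apply: (mulIr uQ); rewrite mulrDl -mulrA divrK // -HE !mevalM ET -Eg.
by ring.
Qed.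

(** A product of linear forms, one for each orbit point whose reduction differs from that of [P]. It
    is invertible in the local ring and removes these points. *)
Lemma avoiding_form l : (l <= n)%N -> exists e f,
  [/\ f \is e.-homog, f.@[P] \is a GRing.unit &
      forall j, (j < l)%N -> ~~ (m %| j)%N -> f.@[q j] = 0].
Proof.
elim: l => [_|l IH lt].
  by exists 0%N, 1; split=> //; [exact: dhomog1|rewrite meval1 unitr1].
have [e [f [Hf uf f0]]] := IH (ltnW lt).
have [ml|nml] := boolP (m %| l)%N.
  exists e, f; split=> // j; rewrite ltnS leq_eqVlt => /orP[/eqP->|/f0 //].
  by rewrite ml.
have [| | |h Hh [h0 uh]] := separating_form (x := P) (y := q l) hk.
- by have [] := qX 0%N.
- by have [] := qX l.
- by move/rmod => E; move: nml; rewrite /dvdn -E mod0n.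
exists (e + 1)%N, (f * h); split.
- exact: dhomogM.
- by rewrite mevalM unitrM uf.
move=> j; rewrite ltnS leq_eqVlt mevalM => /orP[/eqP-> _|lj nmj].
  by rewrite h0 mulr0.
by rewrite f0 ?mul0r.
Qed.

(** Equal values make [F1 * F2' - F1' * F2] vanish at the orbit points reducing to [P]. Multiplied
    by an avoiding form it lies in the orbit ideal, so the two germs are equal. *)
Lemma seq_diff_inj g x g' x' : seq_diff g x -> seq_diff g' x' -> g =1 g' -> x = x'.
Proof.
move=> [e [F1 [F2 [H z <-]]]] [e' [F1' [F2' [H' z' <-]]]] E.
have ms := fraction_max_ideal H z; have ms' := fraction_max_ideal H' z'.
apply: (cotangent_eq hT) => //.
have [d [f [Hf uf f0]]] := avoiding_form (leqnn n).
have [H1 H2 u Eg] := H; have [H1' H2' u' Eg'] := H'.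
exists (map_mpoly rho f), d; split.
- exact: map_mpoly_homog.
- by rewrite map_mpoly_eval -(unit_residue hk).
rewrite /= -!rmorphM -rmorphB -rmorphM; apply: base_change_map.
apply/(orbit_idealE hk hphi (erefl P) qX qS) => i lt.
have Hd : F1 * F2' - F1' * F2 \is (e + e').-homog.
  by apply: rpredB; [exact: dhomogM|rewrite addnC; exact: dhomogM].
apply/(ray_homog_eq0 _ (dhomogM Hf Hd)); rewrite mevalM.
have [/dvdnP[l ->]|nmi] := boolP (m %| i)%N; last by rewrite f0 ?mul0r.
by rewrite mulnC mevalB !mevalM -Eg -Eg' E; ring.
Qed.

(** Pulling a fraction back along [phi^m] and evaluating at [Q i] amounts to evaluating it at
    [Q i.+1]; on differentials this pullback is [M]. *)
Lemma seq_diff_shift g x : seq_diff g x -> seq_diff (fun i => g i.+1) (M x).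
Proof.
move=> [e [F1 [F2 [H z <-]]]]; have [H1 H2 u Eg] := H.
have ms := fraction_max_ideal H z.
have [t st [ut _]] := orbit_chart_exists hphi qX qS 0 m.
have {}st : size t == m by rewrite st.
set G := chart_comp phi t in ut; have [d HG] := comp_homog hphi t.
have E2 : iterate (charts_base_change rho phi) m (Tuple st) = map_tuple (map_mpoly rho) G.
  exact: chart_comp_map.
have ut1 : unimodular (chart_eval (map_tuple (map_mpoly rho) G) a).
  by rewrite -chart_comp_map; apply/(reduced_chart hk).
have Hm : homog_tuple (map_tuple (map_mpoly rho) G).
  by exists d => c; rewrite tnth_map; apply: map_mpoly_homog.
have utQ i : unimodular (chart_eval G (Q i)).
  apply/(reduced_chart hk); rewrite chart_comp_map.
  apply: same_point_unimodular ut1; apply: same_point_chart => //; exact: reduced_orbit.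
have spQ i : same_point (chart_eval G (Q i)) (Q i.+1).
  by have := orbit_chart hk hphi qX qS (utQ i); rewrite (eqP st) mulnS addnC.
(* The unit [w] depends on the degree but not on the form, so it cancels between numerator and
   denominator. *)
have comp e' i : exists2 w, w \is a GRing.unit & forall F : {mpoly R[N.+1]},
    F \is e'.-homog -> F.@[Q i.+1] = w * (F \mPo G).@[Q i].
  have [w uw Ew] := spQ i; exists (w ^+ e'); first exact: unitrX.
  move=> F HF; rewrite (meval_eq _ Ew) (meval_homog_scale _ _ HF).
  by rewrite comp_mpoly_meval.
exists (d * e)%N, (F1 \mPo G), (F2 \mPo G).
have [w0 uw0 Ew0] := comp e 0%N; rewrite muln1 muln0 in Ew0.
have Q1 : q m = Q 1 by rewrite muln1.
split.
- split; try exact: dhomog_comp.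
    have := unit_orbit 1 H2 u; rewrite -Q1 Ew0 // unitrM uw0 //.
  move=> i; have [w uw Ew] := comp e i.
  by apply: (mulrI uw); rewrite mulrCA -!Ew // Eg.
- have [w _] := rho_orbit 1 H1; rewrite z mulr0 -Q1 Ew0 // rmorphM => /eqP.
  by rewrite mulf_eq0 => /orP[|/eqP //]; rewrite -[_ == 0]negbK -(unit_residue hk) uw0.
rewrite (hM (j := Tuple st)) //; last by rewrite E2.
by rewrite E2 /germ_pullback /= !map_mpoly_mPo.
Qed.

Lemma seq_diff_iter l g x : seq_diff g x -> seq_diff (fun i => g (i + l)%N) (iter l M x).
Proof.
elim: l g x => [|l IH] g x H /=.
  by case: H => e [F1 [F2 [[H1 H2 u Eg] z E]]]; exists e, F1, F2; split=> //;
    split=> // i; rewrite addn0.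
have := seq_diff_shift (IH g x H).
case=> e [F1 [F2 [[H1 H2 u Eg] z E]]]; exists e, F1, F2; split=> //; split=> // i.
by rewrite -Eg addnS.
Qed.

Lemma regular_seq_period g : regular_seq g -> forall i j, (m * i = m * j %[mod n])%N ->
  g i = g j.
Proof.
move=> [e [F1 [F2 [H1 H2 u Eg]]]] i j E; have [w uw Ew] := (omod (m * i) (m * j)).2 E.
have := Eg j; rewrite !(meval_eq _ Ew) !(meval_homog_scale _ _ H1).
rewrite !(meval_homog_scale _ _ H2).
rewrite mulrCA -Eg => /(mulrI (unitrX e uw))/(mulIr (unit_orbit i H2 u)) //.
Qed.

Lemma dvd_periods : (m %| n)%N.
Proof.
have sp : same_point (rho \o q 0%N) (rho \o q n).
  by apply: same_point_map; apply/omod; rewrite mod0n modnn.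
by move/rmod: sp; rewrite mod0n /dvdn => <-.
Qed.

Lemma order_decomposition p r : p \in [pchar k] -> order_on M fullv r ->
  (r %| n %/ m)%N -> exists e, n = (m * r * p ^ e)%N.
Proof.
move=> hp [r0 Mr _] rn; have mn := dvd_periods; have [n0 _ _] := hn.
have [m0 _ _] := hm.
have [l El] : exists l, n = (m * r * l)%N.
  by exists ((n %/ m) %/ r)%N; rewrite -mulnA [(r * _)%N]mulnC divnK // mulnC divnK.
have l0 : (0 < l)%N by move: n0; rewrite El muln_gt0 => /andP[].
have pp := pcharf_prime hp.
have [t pt Elt] := pfactor_coprime pp l0; set c := logn p l in Elt.
exists c; pose s0 := (r * p ^ c)%N.
have ut : (t%:R : R) \is a GRing.unit.
  by rewrite (unit_residue hk) rmorph_nat -(dvdn_pcharf hp) -prime_coprime.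
have Ms x : iter s0 M x = x.
  rewrite /s0 mulnC; elim: (p ^ c)%N => [//|b IH].
  by rewrite mulSn iterD IH Mr ?memvf.
have inv := @shift_invariant _ pi regular_seq s0 t hpi ut regular_seq0.
(* As [M] iterated [s0] times is the identity, shifting by [s0] changes a sequence by one with zero
   differential, which is decomposable. *)
have Esep : same_point (Q s0) (Q 0).
  apply: regular_seq_separates => g Ag; rewrite -{1}[s0]add0n; apply: inv Ag _.
    move=> g' Ag' dg'; apply: seq_diff0; have [x sx] := seq_diff_ex Ag' dg'.
    by have := seq_diff_sub (seq_diff_iter s0 sx) sx; rewrite Ms subrr.
  move=> g' Ag' i; apply: regular_seq_period => //.
  have -> : (m * (i + t * s0) = m * i + n)%N by rewrite El Elt /s0; ring.
  by rewrite modnDr.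
have : (n %| m * s0)%N by move/omod: Esep; rewrite muln0 mod0n /dvdn => ->.
have s00 : (0 < m * s0)%N by rewrite !muln_gt0 m0 r0 expn_gt0 prime_gt0.
have -> : (n = m * s0 * t)%N by rewrite El Elt /s0; ring.
(* The full period [m * s0 * t] divides [m * s0], which forces [t = 1]. *)
rewrite -{2}[(m * s0)%N]muln1 dvdn_pmul2l // dvdn1 => /eqP ->.
by rewrite /s0 muln1 mulnA.
Qed.

Lemma period_eq_of_trivial : (forall x : T, x = 0) -> n = m.
Proof.
move=> T0; apply/eqP; rewrite eqn_dvd dvd_periods andbT.
have Esep : same_point (Q 1) (Q 0).
  apply: regular_seq_separates => g Ag.
  apply: (constant_of_decomposable hpi regular_seq0 _ Ag) => g' Ag' dg'.
  by apply: seq_diff0; have [x] := seq_diff_ex Ag' dg'; rewrite (T0 x).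
by move/omod: Esep; rewrite muln0 muln1 mod0n /dvdn => ->.
Qed.

(** A shift by [n %/ m] goes once around the orbit and fixes every sequence; a sequence determines
    its differential by [seq_diff_inj]. *)
Lemma induced_map_period x : iter (n %/ m) M x = x.
Proof.
have [g sg] := seq_diff_exists x.
have Ag : regular_seq g by have [e [F1 [F2 [H _ _]]]] := sg; exists e, F1, F2.
apply: (seq_diff_inj (seq_diff_iter (n %/ m) sg) sg) => i.
apply: regular_seq_period => //.
by rewrite mulnDr [(m * (n %/ m))%N]mulnC divnK ?dvd_periods // modnDr.
Qed.

End Sequences.

(** * Smoothness *)

Lemma det_homog (A : comNzRingType) n s (e : 'I_s -> nat) (B : 'M[{mpoly A[n]}]_s) :
  (forall i j, B i j \is (e i).-homog) -> \det B \is (\sum_i e i).-homog.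
Proof.
move=> H; apply: rpred_sum => t _; rewrite rpredMsign.
apply: (big_ind2 (fun q D => q \is D.-homog)) => //; first exact: dhomog1.
by move=> q D q' D' Hq Hq'; apply: dhomogM.
Qed.

(** The minor is homogeneous, so lying outside the ideal of the point means a nonzero value
    there. *)
Lemma jacobian_unit (A : comNzRingType) (F : fieldType) (f : {rmorphism A -> F}) N s
    (a : 'I_N.+1 -> A) (g : 'I_s -> {mpoly A[N.+1]}) (col : 'I_s -> 'I_N.+1) :
    (forall i, exists e, g i \is e.-homog) ->
    ~ point_ideal f a (\det (\matrix_(i < s, j < s) (g i)^`M(col j))) ->
  colsub col (jacobian (f \o a) (fun i => map_mpoly f (g i))) \in unitmx.
Proof.
move=> Hg; set B := \matrix_(_, _) _ => np.
(* The degree of [g i] is read off from [msize], which exceeds it by one; the second predecessor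
   accounts for the derivative. *)
have HB : \det B \is (\sum_i (msize (g i)).-1.-1).-homog.
  apply: det_homog => i j; rewrite mxE; apply: mderiv_homog.
  by have [e /dhomog_msize] := Hg i.
have -> : colsub col (jacobian (f \o a) (fun i => map_mpoly f (g i))) =
  map_mx f (map_mx (meval a) B).
  by apply/matrixP => i j; rewrite !mxE -map_mpoly_mderiv map_mpoly_eval.
rewrite unitmxE !det_map_mx unitfE; apply/eqP => E; apply: np.
exact/(point_idealE f a HB).
Qed.

Definition gradient (A : comNzRingType) n (a : 'I_n -> A) (f : {mpoly A[n]}) : 'rV_n :=
  \row_j (f^`M(j)).@[a].

Lemma row_jacobian (F : fieldType) N s (a : 'I_N.+1 -> F) (g : 'I_s -> {mpoly F[N.+1]}) i :
  row i (jacobian a g) = gradient a (g i).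
Proof. by apply/rowP => j; rewrite !mxE. Qed.

Lemma gradientM (A : comNzRingType) n (a : 'I_n -> A) (f g : {mpoly A[n]}) : f.@[a] = 0 ->
  gradient a (g * f) = g.@[a] *: gradient a f.
Proof.
by move=> f0; apply/rowP => j; rewrite !mxE mderivM mevalD !mevalM f0 mulr0 add0r.
Qed.

Lemma gradient_sum (A : comNzRingType) n (a : 'I_n -> A) (K : Type) (r : seq K)
    (f : K -> {mpoly A[n]}) :
  gradient a (\sum_(i <- r) f i) = \sum_(i <- r) gradient a (f i).
Proof.
apply/rowP => j; rewrite mxE summxE (raddf_sum (mderiv j)) (raddf_sum (meval a)) /=.
by apply: eq_bigr => i _; rewrite mxE.
Qed.

Lemma map_mpoly_idfun (A : comNzRingType) n (f : {mpoly A[n]}) : map_mpoly idfun f = f.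
Proof. by apply/mpolyP => m; rewrite mcoeff_map_mpoly. Qed.

Lemma colsub_row_free (F : fieldType) s n (col : 'I_s -> 'I_n) (B : 'M[F]_(s, n)) :
  colsub col B \in unitmx -> row_free B.
Proof.
move=> u; rewrite -row_leq_rank.
have {1}<- : \rank (colsub col B) = s by apply/eqP; rewrite -/(row_free _) row_free_unit.
by rewrite -[B in colsub _ B]mulmx1 -mulmx_colsub mxrankM_maxl.
Qed.

Section SmoothDimension.
Variables (R : idomainType) (k : fieldType) (rho : {rmorphism R -> k}).
Hypothesis hk : residue_map rho.
Variables (N : nat) (X : {mpoly R[N.+1]} -> Prop).
Hypothesis hX : homogeneous_ideal X.
Variables (P : 'I_N.+1 -> R).
Hypothesis hP : rational_point X P.

Local Notation frac := (@tofrac R : {rmorphism R -> {fraction R}}).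

(** The [N - r] local equations at the reduction of [P] also generate near the generic point of the
    section, so their gradients span those of all equations there. Among the latter, [N - d] are
    independent. *)
Lemma relative_dimension_le r d :
    smooth_at X (point_ideal rho P) r ->
    smooth_at (generic_fiber X) (point_ideal idfun (frac \o P)) d ->
  (r <= d)%N.
Proof.
move=> [s [g [c [col [Ers gX gspan _]]]]].
move=> [s' [g' [c' [col' [Eds gX' _ [_ _ gdet']]]]]].
set aK := frac \o P in gX' gdet'.
have gh' i : exists e, g' i \is e.-homog by have [] := gX' i.
have := jacobian_unit gh' gdet'.
have -> : jacobian (idfun \o aK) (fun i => map_mpoly idfun (g' i)) = jacobian aK g'.
  by apply/matrixP => i j; rewrite !mxE map_mpoly_idfun.
move/colsub_row_free => free'.
have [_ XP] := hP; have [_ hXh] := hX.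
pose G := jacobian aK (fun i => map_mpoly frac (g i)).
have X0 f : X f -> (map_mpoly frac f).@[aK] = 0.
  move=> Xf; apply: meval_ray0; exact: (point_ideal_vanish frac hX XP Xf).
have gradG f e : X f -> f \is e.-homog -> (gradient aK (map_mpoly frac f) <= G)%MS.
  move=> Xf Hf; have [h [[e' Hh] nph [q Eq]]] := gspan f e Xf Hf.
  (* A denominator that is nonzero at the reduction of [P] is a fortiori nonzero over the fraction
     field. *)
  have h0 : (map_mpoly frac h).@[aK] != 0.
    rewrite map_mpoly_eval /= tofrac_eq0; apply/eqP => E; apply: nph.
    by apply/(point_idealE rho P Hh); rewrite E rmorph0.
  have : (gradient aK (map_mpoly frac (h * f)) <= G)%MS.
    rewrite Eq (rmorph_sum (map_mpoly frac)) /= gradient_sum.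
    apply: summx_sub => i _; have [Xg _] := gX i.
    rewrite (rmorphM (map_mpoly frac)) /= (gradientM _ (X0 _ Xg)).
    apply: scalemx_sub.
    by rewrite -(row_jacobian aK (fun i => map_mpoly frac (g i))) row_sub.
  by rewrite (rmorphM (map_mpoly frac)) /= (gradientM _ (X0 _ Xf)) eqmx_scale.
have gradX f : X f -> (gradient aK (map_mpoly frac f) <= G)%MS.
  move=> Xf; rewrite [f](pihomog_partitionE (mf := mdeg) (leqnn _)).
  rewrite (rmorph_sum (map_mpoly frac)) /= gradient_sum; apply: summx_sub => i _.
  by apply: gradG (pihomogP _ _ _); apply: hXh.
have sub : (jacobian aK g' <= G)%MS.
  apply/row_subP => i; rewrite row_jacobian; have [[l [q [f [Xf ->]]]] _] := gX' i.
  rewrite gradient_sum; apply: summx_sub => j _; rewrite gradientM; last exact: X0.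
  by apply: scalemx_sub; apply: gradX.
have := leq_trans (mxrankS sub) (rank_leq_row _); rewrite (eqP free').
by lia.
Qed.

Lemma special_cotangent_dim (W : vectType k) (dW : germ k N -> W) r :
    cotangent_space (base_change rho X) (rho \o P) dW ->
    smooth_at X (point_ideal rho P) r ->
  (\dim (fullv : {vspace W}) <= r)%N.
Proof.
move=> hW [s [g [c [col [Ers gX _ [npc hcol gdet]]]]]]; have [_ XP] := hP.
have gh i : exists e, g i \is e.-homog by have [] := gX i.
have uJ := jacobian_unit gh gdet.
have ac : (rho \o P) c != 0.
  apply/eqP => E; apply: npc; apply/(@point_idealE _ _ _ _ 1); last by rewrite mevalXU.
  by rewrite dhomogX /= mdeg1.
suff : (\dim (fullv : {vspace W}) + s <= N)%N by lia.
apply: (cotangent_dim (base_change_ideal _ _) hW ac _ _ hcol uJ) => i.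
  have [Xg [e He]] := gX i; split; first exact: base_change_map.
  by exists e; apply: map_mpoly_homog.
by have [Xg [e He]] := gX i; rewrite map_mpoly_eval (XP _ e) // rmorph0.
Qed.

Lemma cotangent_dim_le (W : vectType k) (dW : germ k N -> W) d :
    smooth X -> nonsingular_of_dimension (generic_fiber X) d ->
    cotangent_space (base_change rho X) (rho \o P) dW ->
  (\dim (fullv : {vspace W}) <= d)%N.
Proof.
move=> hXs [_ hXd] hW; have [[i ui] XP] := hP.
have [|r sm] := hXs (point_ideal rho P).
  apply: (is_point_ideal (i := i)); last by rewrite -(unit_residue hk).
  by move=> f; apply: point_ideal_vanish.
apply: leq_trans (special_cotangent_dim hW sm) _.
apply: relative_dimension_le sm (hXd _ _).
apply: (is_point_ideal (i := i)); last first.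
  by rewrite /= tofrac_eq0; apply: contraTneq ui => ->; rewrite unitr0.
move=> _ [l [q [f [Xf ->]]]]; rewrite /point_ideal map_mpoly_idfun.
rewrite (rmorph_sum (ray _)) /= big1 // => j _; rewrite (rmorphM (ray _)) /=.
by rewrite [X in _ * X](point_ideal_vanish frac hX XP (Xf j)) mulr0.
Qed.

End SmoothDimension.

(** * Pullback of germs at a fixed point, and transport of the data to the subspace *)

Lemma max_ideal_pullback (F : fieldType) N (a : 'I_N.+1 -> F)
    (G : N.+1.-tuple {mpoly F[N.+1]}) s :
    homog_tuple G -> same_point (chart_eval G a) a -> max_ideal a s ->
  max_ideal a (germ_pullback G s).
Proof.
move=> [d HG] sp [[s0 [e [s1 s2]]] sa].
have E f : f \is e.-homog -> exists2 u, u \is a GRing.unit & f.@[a] = u * (f \mPo G).@[a].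
  by move=> Hf; rewrite comp_mpoly_meval; apply: meval_same_point sp Hf.
split; last first.
  have [u uu] := E _ s1; rewrite sa /= => /esym/eqP.
  by rewrite mulf_eq0 => /orP[/eqP u0|/eqP //]; rewrite u0 unitr0 in uu.
split; last by exists (d * e)%N; split; apply: dhomog_comp.
have [u uu] := E _ s2; apply: contra_eq_neq => /= ->; rewrite mulr0 //.
Qed.

Lemma base_change_sub (A B : comNzRingType) (f : {rmorphism A -> B}) N
    (I I' : {mpoly A[N.+1]} -> Prop) :
  (forall g, I g -> I' g) -> forall g, base_change f I g -> base_change f I' g.
Proof. by move=> sub g [l [q [h [Hh E]]]]; exists l, q, h; split=> // i; apply: sub. Qed.

Lemma order_on_embedding (F : fieldType) (W T : vectType F) (L : 'End(W)) (M : 'End(T))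
    (g : 'Hom(T, W)) r :
    lker g = 0%VS -> (forall x, g (M x) = L (g x)) -> order_on M fullv r ->
  order_on L (limg g) r.
Proof.
move=> kg gM [r0 Mr rmin].
have it i x : iter i L (g x) = g (iter i M x) by elim: i => //= i ->; rewrite gM.
have ginj : injective g by apply/lker0P; rewrite kg.
split=> // [w /memv_imgP[x _ ->]|s /rmin ns H]; first by rewrite it Mr ?memvf.
apply: ns => x _; apply: ginj; rewrite -it; apply: H; exact: memv_img (memvf _).
Qed.
Theorem theorem1
  (R : idomainType) (v : {fraction R} -> int) (hR : complete_dvr v)
  (k : finFieldType) (rho : {rmorphism R -> k}) (hk : residue_map rho)
  (p : nat) (hp : p \in [pchar k])
  (N d : nat)
  (X : {mpoly R[N.+1]} -> Prop) (hX : homogeneous_ideal X) (hXs : smooth X)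
  (hXv : variety (generic_fiber X))
  (hXd : nonsingular_of_dimension (generic_fiber X) d)
  (J : Type) (phi : charts J R N) (hphi : endomorphism X phi)
  (P : 'I_N.+1 -> R) (hP : rational_point X P)
  (n m : nat) (hn : primitive_period phi P n)
  (hm : primitive_period (charts_base_change rho phi) (rho \o P) m)
  (* W, L: cotangent space of the special fiber, map induced by phi^m *)
  (W : vectType k) (dW : germ k N -> W)
  (hW : cotangent_space (base_change rho X) (rho \o P) dW)
  (L : 'End(W))
  (hL : induced_map (rho \o P) (iterate (charts_base_change rho phi) m) dW L)
  (* T, M: the same for the special fiber of the union of the orbit of P *)
  (T : vectType k) (dT : germ k N -> T)
  (hT : cotangent_space (base_change rho (orbit_ideal phi P n)) (rho \o P) dT)
  (M : 'End(T))
  (hM : induced_map (rho \o P) (iterate (charts_base_change rho phi) m) dT M) :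
  n = m \/
  exists (V : {vspace W}) (r e : nat),
    [/\ (L @: V <= V)%VS,
        order_on L V r /\ n = (m * r * p ^ e)%N,
        identified_with L V M,
        (\dim V <= d)%N
      & (r <= #|k| ^ \dim V - 1)%N].
Proof.
have [pi hpi] := dvr_uniformizer hR.
have [q [q0 qX qS]] := orbit_exists hk hX hphi hP.
subst P.
(* The zero space must go to the first alternative: in dimension 0 the bound on [r] would read
   [r <= 0]. *)
have [/eqP T0|T0] := posnP (\dim (fullv : {vspace T})).
  left; apply: (period_eq_of_trivial hk hpi hphi qX qS hn hm hT) => x.
  by apply/eqP; rewrite -memv0; move: T0; rewrite dimv_eq0 => /eqP <-; apply: memvf.
right; have mn := dvd_periods hk hphi qX qS hn hm.
have Mper := induced_map_period hk hpi hphi qX qS hn hm hT hM.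
have nm0 : (0 < n %/ m)%N.
  by have [n0 _ _] := hn; have [m0 _ _] := hm; rewrite divn_gt0 // dvdn_leq.
have [r [Mr rn]] := order_exists nm0 Mper.
have [e En] := order_decomposition hk hpi hphi qX qS hn hm hT hM hp Mr rn.
(* The whole orbit lies on the scheme of [X], so the cotangent space [T] of the orbit is a quotient
   of [W]. *)
have sub f : X f -> orbit_ideal phi (q 0%N) n f.
  move=> Xf; apply/(orbit_idealE hk hphi (erefl (q 0%N)) qX qS) => i _.
  have [_ XP] := qX i.
  have := point_ideal_vanish idfun hX XP Xf.
  by rewrite /point_ideal map_mpoly_idfun.
have [Q hQ] := cotangent_quotient (base_change_sub sub) hW hT.
have [_ _ _ Wsurj] := hW; have [_ _ _ Tsurj] := hT.
have [t [ut st]] :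
    sends (iterate (charts_base_change rho phi) m) (rho \o q 0%N) (rho \o q 0%N).
  by have [] := hm.
have QL w : Q (L w) = M (Q w).
  have [s ms <-] := Wsurj w; rewrite (hL t) // !hQ ?(hM t) //.
  apply: max_ideal_pullback => //; rewrite /iterate.
  apply: chart_comp_homog => j; have [d' Hd] := phi_homog hphi j.
  by exists d' => c; rewrite tnth_map; apply: map_mpoly_homog.
have Qsurj x : exists w, Q w = x.
  by have [s ms <-] := Tsurj x; exists (dW s); rewrite hQ.
(* The quotient [T] is turned into the stable subspace [V := limg g], on which [L] acts as [M] does
   on [T]. *)
have [g kg gM] := hom_quotient_embeds Qsurj QL.
have dimV : \dim (limg g) = \dim (fullv : {vspace T}).
  by apply: limg_dim_eq; rewrite kg capv0.
exists (limg g), r, e; split.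
- apply/subvP => _ /memv_imgP[_ /memv_imgP[x _ ->] ->].
  by rewrite -gM memv_img ?memvf.
- by split=> //; apply: order_on_embedding Mr.
- by exists g.
- apply: leq_trans (dimvS (subvf _)) _.
  exact: (cotangent_dim_le hk hX (qX 0%N) hXs hXd hW).
- by rewrite dimV; apply: (hom_order_bound T0 Mr).
Qed.
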